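(* Let $M$ be a finite-dimensional, connected, complete, smooth Riemannian manifold with geodesic distance $d$, and let $X$ be a random variable on $M$ with distribution $\mathbb{P}^X$ such that $\int_M d(q,x)^2\,d\mathbb{P}^X(x)<\infty$ for one (hence for all) $q\in M$. Let $F:M\to\mathbb{R}$, $F(q)=\int_M d(q,x)^2\,d\mathbb{P}^X(x)$, be the Fréchet function. If $\mu\in M$ is a local minimum of $F$, then $F$ is differentiable at $\mu$ and $D_\mu F\equiv 0$.
   Context: For a function $f$ defined near $q\in M$ and $w\in T_qM$, $D_qf(w):=\lim_{t\searrow 0}\frac{f(\exp_q(tw))-f(q)}{t}$ denotes the one-sided directional derivative. *)

(* Defs.v *)
From HB Require Import structures.
From mathcomp Require Import all_boot all_order all_algebra.
From mathcomp Require Import all_classical all_reals all_analysis.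

Set Implicit Arguments.
Unset Strict Implicit.
Unset Printing Implicit Defensive.

Import Order.TTheory GRing.Theory Num.Theory.
Import numFieldNormedType.Exports.

Local Open Scope classical_set_scope.
Local Open Scope ring_scope.

(* In finite dimension, C^(k+1) on an open set means differentiable there
   with every directional derivative of class C^k. *)
Fixpoint Ck_on (R : realType) (V W : normedModType R) (k : nat) (U : set V)
    (f : V -> W) : Prop :=
  if k is k'.+1 then
    (forall x, U x -> differentiable f x) /\
    (forall v : V, Ck_on k' U (fun x => 'D_v f x))
  else forall x, U x -> {for x, continuous f}.

Definition smooth_on (R : realType) (V W : normedModType R) (U : set V)
    (f : V -> W) : Prop := forall k : nat, Ck_on k U f.

(* The values of chart_map outside chart_dom, and of chart_inv outside
   chart_img, are irrelevant. *)
Record chart (R : realType) (n : nat) (M : topologicalType) := Chart {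
  chart_dom : set M ;
  chart_img : set 'rV[R]_n ;
  chart_map : M -> 'rV[R]_n ;
  chart_inv : 'rV[R]_n -> M ;
  chart_dom_open : open chart_dom ;
  chart_img_open : open chart_img ;
  chart_mapP : forall p, chart_dom p -> chart_img (chart_map p) ;
  chart_invP : forall x, chart_img x -> chart_dom (chart_inv x) ;
  chart_mapK : forall p, chart_dom p -> chart_inv (chart_map p) = p ;
  chart_invK : forall x, chart_img x -> chart_map (chart_inv x) = x ;
  chart_map_continuous : forall p, chart_dom p -> {for p, continuous chart_map} ;
  chart_inv_continuous : forall x, chart_img x -> {for x, continuous chart_inv}
}.

(* A smooth structure is presented by a (not necessarily maximal) atlas. *)
Record smooth_structure (R : realType) (n : nat) (M : topologicalType) :=
    SmoothStructure {
  atlas : set (chart R n M) ;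
  atlas_cover : forall p : M, exists2 c, atlas c & chart_dom c p ;
  atlas_smooth : forall c c', atlas c -> atlas c' ->
    smooth_on (chart_img c `&` chart_inv c @^-1` chart_dom c')
      (chart_map c' \o chart_inv c)
}.

Definition bilin (R : realType) (n : nat) (G : 'M[R]_n) (u v : 'rV[R]_n) : R :=
  (u *m G *m v^T) 0 0.

(* gram c x is the matrix of the metric in the coordinates of c, at the point
   with coordinates x; the last field says that the various gram c represent
   the same tensor. *)
Record riemannian_metric (R : realType) (n : nat) (M : topologicalType)
    (S : smooth_structure R n M) := RiemannianMetric {
  gram : chart R n M -> 'rV[R]_n -> 'M[R]_n ;
  gram_smooth : forall c, atlas S c -> smooth_on (chart_img c) (gram c) ;
  gram_sym : forall c x, atlas S c -> chart_img c x ->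
    (gram c x)^T = gram c x ;
  gram_pos : forall c x (v : 'rV[R]_n), atlas S c -> chart_img c x ->
    v != 0 -> 0 < bilin (gram c x) v v ;
  gram_tensor : forall c c' p (u v : 'rV[R]_n), atlas S c -> atlas S c' ->
    chart_dom c p -> chart_dom c' p ->
    let x := chart_map c p in
    let phi := chart_map c' \o chart_inv c in
    bilin (gram c x) u v = bilin (gram c' (phi x)) ('d phi x u) ('d phi x v)
}.

Section Riemannian.
Context (R : realType) (n : nat) (M : ptopologicalType).
Context (S : smooth_structure R n M) (g : riemannian_metric S).

(* A chosen chart around each point: the tangent space at p is identified with
   'rV[R]_n through the coordinates of chart_at p. *)
Definition chart_at (p : M) : chart R n M := s2val (cid2 (atlas_cover S p)).

Definition inner (p : M) (u v : 'rV[R]_n) : R :=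
  bilin (gram g (chart_at p) (chart_map (chart_at p) p)) u v.

Definition velocity (s : R -> M) (t : R) : 'rV[R]_n :=
  derive1 (chart_map (chart_at (s t)) \o s) t.

Definition speed (s : R -> M) (t : R) : R :=
  Num.sqrt (inner (s t) (velocity s t) (velocity s t)).

Definition C1_curve_on (U : set R) (s : R -> M) : Prop :=
  forall t, U t -> {for t, continuous s} /\
    forall c, atlas S c -> chart_dom c (s t) ->
      derivable (chart_map c \o s) t 1 /\
      {for t, continuous (derive1 (chart_map c \o s))}.

(* Every C^1 curve on the closed interval [0, 1] extends to a C^1 curve on a
   neighbourhood of it. *)
Definition C1_segment (s : R -> M) : Prop :=
  exists U : set R, [/\ open U, `[0, 1] `<=` U & C1_curve_on U s].

(* A piecewise C^1 path is the list of its consecutive C^1 pieces, each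
   parametrised by [0, 1]. *)
Fixpoint piecewise_C1_path (p : M) (l : seq (R -> M)) (q : M) : Prop :=
  if l is s :: l' then
    [/\ C1_segment s, s 0 = p & piecewise_C1_path (s 1) l' q]
  else p = q.

Definition path_length (l : seq (R -> M)) : R :=
  \sum_(s <- l) \int[@lebesgue_measure R]_(t in `[0, 1]) speed s t.

Definition dist (p q : M) : R :=
  inf [set path_length l | l in [set l | piecewise_C1_path p l q]].

Definition metrically_complete : Prop :=
  forall u : nat -> M,
    (forall e : R, 0 < e -> \forall i & j \near \oo, dist (u i) (u j) < e) ->
    exists q : M, dist (u i) q @[i --> \oo] --> (0 : R).

(* Gamma^k_ab
     = 1/2 sum_l g^kl (d_a g_lb + d_b g_la - d_l g_ab) *)
Definition christoffel (c : chart R n M) (x : 'rV[R]_n) (k a b : 'I_n) : R :=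
  let dg (e i j : 'I_n) := ('D_(delta_mx 0 e) (gram g c) x : 'M[R]_n) i j in
  2^-1 * \sum_(l < n)
    invmx (gram g c x) k l * (dg a l b + dg b l a - dg l a b).

Definition geodesic (s : R -> M) : Prop :=
  forall t : R, {for t, continuous s} /\
    forall c, atlas S c -> chart_dom c (s t) ->
      let x := chart_map c \o s in
      let dx := derive1 x in
      [/\ derivable x t 1, derivable dx t 1 &
        forall k : 'I_n, (derive1 dx t) 0 k =
          - \sum_(a < n) \sum_(b < n)
              christoffel c (x t) k a b * dx t 0 a * dx t 0 b].

(* exp_q(v) is the value at time 1 of the geodesic starting at q with velocity
   v. On a complete manifold this geodesic is defined on the whole real line
   and is unique, so that the default value of xget is not used. *)
Definition exp_map (q : M) (v : 'rV[R]_n) : M :=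
  xget (cst q) [set s | [/\ geodesic s, s 0 = q & velocity s 0 = v]] 1.

Definition has_dirderiv (f : M -> R) (q : M) (w : 'rV[R]_n) (l : R) : Prop :=
  (f (exp_map q (t *: w)) - f q) / t @[t --> 0^'+] --> l.

Definition differentiable_at (f : M -> R) (q : M) : Prop :=
  forall c, atlas S c -> chart_dom c q ->
    differentiable (f \o chart_inv c) (chart_map c q).

Definition local_minimum (f : M -> R) (q : M) : Prop :=
  \forall p \near q, f q <= f p.

Definition frechet (Q : probability (g_sigma_algebraType (@open M)) R)
    (q : M) : R :=
  \int[Q]_x (dist q x ^+ 2).

End Riemannian.

(* Main.v *)
Require Import Defs.
From HB Require Import structures.
From mathcomp Require Import all_boot all_order all_algebra.
From mathcomp Require Import all_classical all_reals all_analysis.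
From mathcomp Require Import measurable_realfun.
From mathcomp Require Import ring lra.

(** The Frechet function [F] is differentiable at a local minimum [mu] because it
    is semiconcave: a function bounded above near [mu] by a smooth function that
    touches it at [mu], and bounded below by its own value there, is squeezed.
    Semiconcavity is used through symmetric second differences, in which the
    linear terms cancel, so that no superdifferential of the squared distance has
    to be chosen, let alone chosen measurably in the far point.

    In a chart around [mu], for small vectors [h] and all points [q],
<<
      d(mu + h, q)^2 + d(mu - h, q)^2
        <= 2 d(mu, q)^2 + C |h|^2 (1 + d(mu, q)^2).
>>
    This is [dist_sq_second_difference].  The right-hand side is integrable, and
    integration gives [F(mu + h) + F(mu - h) <= 2 F(mu) + C' |h|^2].  Since
    [F(mu - h) >= F(mu)] at a local minimum, [0 <= F(mu + h) - F(mu) <= C' |h|^2]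
    ([frechet_quadratic_at_minimum]), and [F] has differential zero at [mu].

    The bound on distances comes from perturbing paths and needs neither minimal
    geodesics nor the exponential map.  Take a nearly shortest path from [mu] to
    [q], and shift its beginning in the chart by [phi(s) h] and by [- phi(s) h],
    where [s] is the arc length and [phi] decreases from 1 at [s = 0] to 0 at
    [s = rho].  The two new paths end at [q] and start at [mu + h] and [mu - h].
    If [sigma] is the speed of the path, the inequality
    [|v| <= (|v|^2 / sigma + sigma) / 2] for the new velocities [v] bounds the sum
    of their lengths by a sum of squared norms; there the terms linear in [h]
    cancel and the second difference of the metric is of order [|h|^2]
    ([speed_pair_bound]).  The construction requires that the beginning of the
    path lies in the chart, which [containment] derives from its short length.

    For the directional derivative, geodesics have constant speed, so the
    exponential of [t w] is at distance of order [t] from [mu] ([exp_map_close])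
    and the increment of [F] is of order [t^2]. *)

Import Order.TTheory GRing.Theory Num.Theory.
Import numFieldNormedType.Exports.

Local Open Scope classical_set_scope.
Local Open Scope ring_scope.

Set Implicit Arguments.
Unset Strict Implicit.
Unset Printing Implicit Defensive.

(** * Continuously differentiable curves in a normed space *)

Section Calculus.
Context (R : realType).

Lemma derive1_chain (V W : normedModType R) (f : V -> W) (x : R -> V) (t : R) :
  derivable x t 1 -> differentiable f (x t) ->
  derivable (f \o x) t 1 /\ derive1 (f \o x) t = 'd f (x t) (derive1 x t).
Proof.
move=> /derivable1_diffP dx df.
have dfx : differentiable (f \o x) t by exact: differentiable_comp.
split; first exact/derivable1_diffP.
by rewrite !derive1E' // diff_comp.
Qed.

Lemma diff_coords n (W : normedModType R) (f : 'rV[R]_n -> W) (p w : 'rV[R]_n) :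
  differentiable f p ->
  'd f p w = \sum_(i < n) w 0 i *: 'D_(delta_mx 0 i) f p.
Proof.
move=> df; rewrite [in LHS](row_sum_delta w) linear_sum.
by apply: eq_bigr => i _; rewrite linearZ deriveE.
Qed.

Lemma derivable1_continuous (V : normedModType R) (x : R -> V) (t : R) :
  derivable x t 1 -> {for t, continuous x}.
Proof. by move=> /derivable1_diffP /differentiable_continuous. Qed.

(** Differentiability is asked on a whole neighbourhood, so that the derivative
    near [t], and hence its continuity at [t], depends only on the germ. *)
Definition C1_at (V : normedModType R) (x : R -> V) (t : R) : Prop :=
  (\forall s \near t, derivable x s 1) /\ {for t, continuous (derive1 x)}.

Lemma near_eq_derive1 (V : normedModType R) (x y : R -> V) (t : R) :
  {near t, x =1 y} -> derive1 x t = derive1 y t.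
Proof. by move=> xy; rewrite !derive1E; exact: near_eq_derive. Qed.

Lemma near_eq_C1_at (V : normedModType R) (x y : R -> V) (t : R) :
  {near t, x =1 y} -> C1_at x t -> C1_at y t.
Proof.
move=> xy [dx cx].
have xy' : \forall s \near t, {near s, x =1 y} by exact: near_join.
split.
  near=> s; apply: (@near_eq_derivable _ _ _ x); first by near: s.
  by near: s.
rewrite /prop_for /continuous_at -(near_eq_derive1 xy).
apply: cvg_trans cx; apply: near_eq_cvg.
by near=> s; apply: near_eq_derive1; near: s.
Unshelve. all: by end_near. Qed.

Lemma C1_at_derivable (V : normedModType R) (x : R -> V) (t : R) :
  C1_at x t -> derivable x t 1.
Proof. by move=> [dx _]; exact: nbhs_singleton dx. Qed.

Lemma C1_at_continuous (V : normedModType R) (x : R -> V) (t : R) :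
  C1_at x t -> {for t, continuous x}.
Proof. by move=> /C1_at_derivable /derivable1_continuous. Qed.

Lemma cvg_coord m n (T : Type) (F : set_system T) {FF : Filter F}
    (f : T -> 'M[R]_(m, n)) (l : 'M[R]_(m, n)) i j :
  f @ F --> l -> f t i j @[t --> F] --> l i j.
Proof.
move=> fl.
apply: (@cvg_comp _ _ _ f (fun M : 'M[R]_(m, n) => M i j) F _ _ fl).
exact: coord_continuous.
Qed.

Lemma cvg_finsum (T : Type) (F : set_system T) {FF : Filter F}
    (W : normedModType R) (I : finType) (f : I -> T -> W) (l : I -> W) :
  (forall i, f i t @[t --> F] --> l i) ->
  \sum_i f i t @[t --> F] --> \sum_i l i.
Proof.
by move=> fl; apply: cvg_big => [|i _]; [exact: add_continuous|exact: fl].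
Qed.

(** In coordinates the derivative of [f \o x] is a finite sum of products of
    coordinates of the velocity with partial derivatives of [f], and each factor
    is continuous. *)
Lemma C1_at_comp n (W : normedModType R) (U : set 'rV[R]_n)
    (f : 'rV[R]_n -> W) (x : R -> 'rV[R]_n) (t : R) :
  open U -> Ck_on 1 U f -> U (x t) -> C1_at x t -> C1_at (f \o x) t.
Proof.
move=> oU [df cf] Uxt Cx; have cx := C1_at_continuous Cx.
have nU : \forall s \near t, U (x s).
  by apply: cx; exact: open_nbhs_nbhs.
have [dx cdx] := Cx.
split.
  near=> s; apply: (derive1_chain _ _).1; first by near: s.
  by apply: df; near: s.
have E : \forall s \near t, derive1 (f \o x) s =
    \sum_(i < n) (derive1 x s) 0 i *: 'D_(delta_mx 0 i) f (x s).
  near=> s; have dfs : differentiable f (x s) by apply: df; near: s.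
  have dxs : derivable x s 1 by near: s.
  by rewrite (derive1_chain dxs dfs).2 (diff_coords _ dfs).
rewrite /prop_for /continuous_at (nbhs_singleton E).
apply: (@cvg_trans _ ((fun s => \sum_(i < n) (derive1 x s) 0 i *: 'D_(delta_mx 0 i) f (x s)) @ t)).
  by apply: near_eq_cvg; near=> s; apply/esym; near: s.
pose term i s := derive1 x s 0 i *: 'D_(delta_mx 0 i) f (x s).
have terms i : term i s @[s --> t] --> term i t.
  apply: cvgZ; first exact: cvg_coord cdx.
  apply: (@cvg_comp _ _ _ x (fun y => 'D_(delta_mx 0 i) f y) _ _ _ cx).
  exact: (cf (delta_mx 0 i) _ Uxt).
exact: (cvg_finsum terms).
Unshelve. all: by end_near. Qed.

Lemma C1_atD (V : normedModType R) (x y : R -> V) (t : R) :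
  C1_at x t -> C1_at y t -> C1_at (fun s => x s + y s) t.
Proof.
move=> [dx cx] [dy cy]; split.
  by near=> s; apply: derivableD; near: s.
have E : \forall s \near t, derive1 (fun s => x s + y s) s = derive1 x s + derive1 y s.
  by near=> s; rewrite !derive1E deriveD //; near: s.
rewrite /prop_for /continuous_at (nbhs_singleton E).
apply: (@cvg_trans _ ((fun s => derive1 x s + derive1 y s) @ t)).
  by apply: near_eq_cvg; near=> s; apply/esym; near: s.
exact: (cvgD cx cy).
Unshelve. all: by end_near. Qed.

Lemma derive1Zl (V : normedModType R) (k : R -> R) (h : V) (t : R) :
  derivable k t 1 ->
  derivable (fun s => k s *: h) t 1 /\ derive1 (fun s => k s *: h) t = derive1 k t *: h.
Proof.
move=> dk; have dZ : differentiable ( *:%R ^~ h : R -> V) (k t).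
  exact: ex_diff.
have [d e] := derive1_chain dk dZ; split => //.
by rewrite e diff_val.
Qed.

Lemma C1_atZl (V : normedModType R) (k : R -> R) (h : V) (t : R) :
  C1_at k t -> C1_at (fun s => k s *: h) t.
Proof.
move=> [dk ck]; split.
  by near=> s; apply: (derive1Zl h _).1; near: s.
have E : \forall s \near t, derive1 (fun s => k s *: h) s = derive1 k s *: h.
  near=> s; have dks : derivable k s 1 by near: s.
  by rewrite (derive1Zl h dks).2.
rewrite /prop_for /continuous_at (nbhs_singleton E).
apply: (@cvg_trans _ ((fun s => derive1 k s *: h) @ t)).
  by apply: near_eq_cvg; near=> s; apply/esym; near: s.
exact: (cvgZr_tmp ck).
Unshelve. all: by end_near. Qed.

End Calculus.

(** * Curves on the manifold and their speed *)

Section Curves.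
Context (R : realType) (n : nat) (M : ptopologicalType).
Context (S : smooth_structure R n M) (g : riemannian_metric S).
Implicit Types (c : chart R n M) (s : R -> M) (t : R).

Lemma chart_at_atlas (p : M) : atlas S (chart_at S p).
Proof. exact: (s2valP (cid2 (atlas_cover S p))). Qed.

Lemma chart_at_dom (p : M) : chart_dom (chart_at S p) p.
Proof. exact: (s2valP' (cid2 (atlas_cover S p))). Qed.

Definition C1_curve_at s t : Prop :=
  {for t, continuous s} /\
  forall c, atlas S c -> chart_dom c (s t) -> C1_at (chart_map c \o s) t.

Lemma near_chart_dom c s t : {for t, continuous s} -> chart_dom c (s t) ->
  \forall u \near t, chart_dom c (s u).
Proof.
by move=> cs dct; apply: cs; apply: open_nbhs_nbhs; split => //; exact: chart_dom_open.
Qed.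

Lemma C1_curve_on_at (U : set R) s t :
  open U -> C1_curve_on S U s -> U t -> C1_curve_at s t.
Proof.
move=> oU CU Ut; have [cs Cs] := CU _ Ut; split; first exact: cs.
move=> c ac dct; split.
  have nU : \forall u \near t, U u by apply: open_nbhs_nbhs.
  have nc := near_chart_dom cs dct.
  near=> u; have [_ /(_ c ac)[]//] : {for u, continuous s} /\
    forall c, atlas S c -> chart_dom c (s u) ->
      derivable (chart_map c \o s) u 1 /\
      {for u, continuous (derive1 (chart_map c \o s))}.
    by apply: CU; near: u.
  by near: u.
by have [] := Cs c ac dct.
Unshelve. all: by end_near. Qed.

Lemma C1_curve_at_on (U : set R) s :
  (forall t, U t -> C1_curve_at s t) -> C1_curve_on S U s.
Proof.
move=> CU t /CU[cs Cs]; split; first exact: cs.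
move=> c ac dct; split.
  exact: C1_at_derivable (Cs c ac dct).
by have [] := Cs c ac dct.
Qed.

Lemma near_eq_C1_curve_at s s' t :
  {near t, s =1 s'} -> C1_curve_at s t -> C1_curve_at s' t.
Proof.
move=> ss' [cs Cs]; have e := nbhs_singleton ss'; split.
  rewrite /prop_for /continuous_at -e; apply: cvg_trans cs.
  exact: near_eq_cvg.
move=> c ac; rewrite -e => dct; apply: near_eq_C1_at (Cs c ac dct).
by near=> u; rewrite /=; congr chart_map; near: u.
Unshelve. all: by end_near. Qed.

Lemma transition_domain_open c c' : open (chart_img c `&` chart_inv c @^-1` chart_dom c').
Proof.
rewrite openE => x [ix dx].
have : nbhs x (chart_img c `&` [set y | chart_dom c' (chart_inv c y)]).
  apply: filterI; first by apply: open_nbhs_nbhs; split=> //; exact: chart_img_open.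
  apply: (chart_inv_continuous ix); apply: open_nbhs_nbhs; split=> //.
  exact: chart_dom_open.
by [].
Qed.

(** One chart is enough to test smoothness of a curve: the transition maps carry
    the property to every other chart of the atlas. *)
Lemma C1_curve_of_coords c (y : R -> 'rV[R]_n) t : atlas S c ->
  chart_img c (y t) -> C1_at y t -> C1_curve_at (chart_inv c \o y) t.
Proof.
move=> ac iy Cy; split.
  apply: (@cvg_comp _ _ _ y (chart_inv c) _ _ _ (C1_at_continuous Cy)).
  exact: chart_inv_continuous.
move=> c' ac' dy.
suff : C1_at ((chart_map c' \o chart_inv c) \o y) t by [].
 apply: (@C1_at_comp _ _ _ _ (chart_map c' \o chart_inv c) y t
  (@transition_domain_open c c')).
- exact: (atlas_smooth ac ac' 1%N).
- by [].
- by [].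
Qed.

Lemma near_chart_comp c s t : {for t, continuous s} -> chart_dom c (s t) ->
  {near t, s =1 chart_inv c \o (chart_map c \o s)}.
Proof.
move=> cs dct; have nc := near_chart_dom cs dct.
by near=> u; rewrite /= chart_mapK //; near: u.
Unshelve. all: by end_near. Qed.

(** The speed is defined through the chart chosen at the point of the curve,
    which jumps as the curve moves; tensoriality of the metric lets any fixed
    chart compute it. *)
Lemma speed_chart c s t : atlas S c -> chart_dom c (s t) ->
  {for t, continuous s} -> derivable (chart_map c \o s) t 1 ->
  let x := chart_map c \o s in
  speed g s t =
  Num.sqrt (bilin (gram g c (x t)) (derive1 x t) (derive1 x t)).
Proof.
move=> ac dct cs dx x.
suff E : bilin (gram g c (x t)) (derive1 x t) (derive1 x t) =
    inner g (s t) (velocity S s t) (velocity S s t) by rewrite E.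
set c' := chart_at S (s t).
have ac' : atlas S c' by exact: chart_at_atlas.
have dct' : chart_dom c' (s t) by exact: chart_at_dom.
rewrite (gram_tensor g (derive1 x t) (derive1 x t) ac ac' dct dct').
have -> : (chart_map c' \o chart_inv c) (chart_map c (s t)) = chart_map c' (s t).
  by rewrite /= chart_mapK.
rewrite /inner -/c'.
suff -> : 'd (chart_map c' \o chart_inv c) (x t) (derive1 x t) = velocity S s t by [].
have ix : (chart_img c `&` chart_inv c @^-1` chart_dom c') (x t).
  by split; [exact: chart_mapP|rewrite /= chart_mapK].
have [df _] := atlas_smooth ac ac' 1%N.
rewrite -(derive1_chain dx (df _ ix)).2 /velocity -/c'; apply: near_eq_derive1.
have nE := near_chart_comp cs dct.
near=> u; rewrite /=; congr chart_map; apply: esym; rewrite -/((chart_inv c \o x) u).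
by near: u.
Unshelve. all: by end_near. Qed.

Lemma gram_continuous c x : atlas S c -> chart_img c x ->
  {for x, continuous (gram g c)}.
Proof. by move=> ac ix; exact: (gram_smooth g ac 0%N). Qed.

Lemma bilinE (G : 'M[R]_n) (u v : 'rV[R]_n) :
  bilin G u v = \sum_(j < n) \sum_(i < n) u 0 i * G i j * v 0 j.
Proof.
rewrite /bilin mxE; apply: eq_bigr => j _; rewrite !mxE big_distrl.
by apply: eq_bigr.
Qed.

Lemma cvg_bilin (T : Type) (F : set_system T) {FF : Filter F}
    (G : T -> 'M[R]_n) (u v : T -> 'rV[R]_n) G0 u0 v0 :
  G @ F --> G0 -> u @ F --> u0 -> v @ F --> v0 ->
  bilin (G t) (u t) (v t) @[t --> F] --> bilin G0 u0 v0.
Proof.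
move=> cG cu cv; rewrite bilinE.
under eq_fun do rewrite bilinE.
have term j i : u t 0 i * G t i j * v t 0 j @[t --> F] --> u0 0 i * G0 i j * v0 0 j.
  by apply: cvgM; [apply: cvgM|]; exact: cvg_coord.
exact: (cvg_finsum (fun j => cvg_finsum (term j))).
Qed.

(** Near [t] a single chart computes the speed, and there it is a continuous
    expression in the position and the velocity. *)
Lemma speed_continuous s t : C1_curve_at s t -> {for t, continuous (speed g s)}.
Proof.
move=> Cst; have [cs Cs] := Cst.
set c := chart_at S (s t).
have ac : atlas S c by exact: chart_at_atlas.
have dct : chart_dom c (s t) by exact: chart_at_dom.
have Cx := Cs c ac dct; have [dx cdx] := Cx.
pose x := chart_map c \o s.
have E : \forall u \near t, speed g s u =
    Num.sqrt (bilin (gram g c (x u)) (derive1 x u) (derive1 x u)).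
  have nc := near_chart_dom cs dct.
  have ncs : \forall u \near t, {for u, continuous s}.
    have nx : \forall u \near t, {for u, continuous x}.
      by near=> u; apply: derivable1_continuous; near: u.
    have ne := near_join (near_chart_comp cs dct).
    near=> u; have eu : {near u, s =1 chart_inv c \o x} by near: u.
    rewrite /prop_for /continuous_at (nbhs_singleton eu).
    apply: (@cvg_trans _ ((chart_inv c \o x) @ u)).
      by apply: near_eq_cvg; apply: filterS eu => w; exact: esym.
    have cxu : {for u, continuous x} by near: u.
    apply: (@cvg_comp _ _ _ x (chart_inv c) _ _ _ cxu).
    by apply: chart_inv_continuous; apply: chart_mapP; near: u.
  near=> u; have dcu : chart_dom c (s u) by near: u.
  have csu : {for u, continuous s} by near: u.
  have dxu : derivable x u 1 by near: u.
  exact: (speed_chart ac dcu csu dxu).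
rewrite /prop_for /continuous_at (nbhs_singleton E).
pose b u := bilin (gram g c (x u)) (derive1 x u) (derive1 x u).
apply: (@cvg_trans _ ((fun u => Num.sqrt (b u)) @ t)).
  by apply: near_eq_cvg; near=> u; apply/esym; near: u.
apply: (@cvg_comp _ _ _ b Num.sqrt); last exact: sqrt_continuous.
apply: cvg_bilin => //.
apply: (@cvg_comp _ _ _ x (gram g c) _ _ _ (C1_at_continuous Cx)).
by apply: gram_continuous => //; exact: chart_mapP.
Unshelve. all: by end_near. Qed.

Lemma speed_ge0 s t : 0 <= speed g s t.
Proof. exact: sqrtr_ge0. Qed.

End Curves.

(** * Mean value inequalities and bilinear forms *)

Section LocalBounds.
Context (R : realType).

Lemma coord_le_norm m n (A : 'M[R]_(m, n)) i j : `|A i j| <= `|A|.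
Proof.
by rewrite [leRHS]/Num.Def.normr/= mx_normrE; apply: (le_bigmax _ _ (i, j)).
Qed.

Lemma norm_le_coord m n (A : 'M[R]_(m, n)) (e : R) :
  0 <= e -> (forall i j, `|A i j| <= e) -> `|A| <= e.
Proof.
move=> e0 Ae; rewrite [leLHS]/Num.Def.normr/= mx_normrE.
by apply: bigmax_le => // i _; exact: Ae.
Qed.

Lemma near_norm_le (V W : normedModType R) (f : V -> W) (x0 : V) :
  {for x0, continuous f} -> \forall x \near x0, `|f x| <= `|f x0| + 1.
Proof.
move=> cf; have /cvgrPdist_le /(_ _ ltr01) := cf; apply: filterS => x /= fx.
by rewrite -[f x](subrK (f x0)) addrC (le_trans (ler_normD _ _))// lerD2l distrC.
Qed.

Lemma bilin_norm n (G : 'M[R]_n) (u v : 'rV[R]_n) :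
  `|bilin G u v| <= n%:R ^+ 2 * `|G| * `|u| * `|v|.
Proof.
rewrite bilinE (le_trans (ler_norm_sum _ _ _))//.
apply: (@le_trans _ _ (\sum_(j < n) \sum_(i < n) (`|G| * `|u| * `|v|))).
  apply: ler_sum => j _; rewrite (le_trans (ler_norm_sum _ _ _))//.
  apply: ler_sum => i _; rewrite !normrM [_ * `|u|]mulrC.
  by rewrite !ler_pM ?mulr_ge0 ?coord_le_norm.
rewrite !sumr_const card_ord -[leLHS]mulr_natl -[X in _ * X <= _]mulr_natl.
rewrite le_eqVlt; apply/orP; left; apply/eqP.
by ring.
Qed.

Lemma bilinD n (G H : 'M[R]_n) (u v : 'rV[R]_n) :
  bilin (G + H) u v = bilin G u v + bilin H u v.
Proof. by rewrite /bilin mulmxDr mulmxDl mxE. Qed.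

Lemma bilinN n (G : 'M[R]_n) (u v : 'rV[R]_n) :
  bilin (- G) u v = - bilin G u v.
Proof. by rewrite /bilin mulmxN mulNmx mxE. Qed.

Lemma bilinDl n (G : 'M[R]_n) (u w v : 'rV[R]_n) :
  bilin G (u + w) v = bilin G u v + bilin G w v.
Proof. by rewrite /bilin !mulmxDl mxE. Qed.

Lemma bilinDr n (G : 'M[R]_n) (u w v : 'rV[R]_n) :
  bilin G v (u + w) = bilin G v u + bilin G v w.
Proof. by rewrite /bilin linearD /= !mulmxDr mxE. Qed.

Lemma bilinZl n (G : 'M[R]_n) a (u v : 'rV[R]_n) :
  bilin G (a *: u) v = a * bilin G u v.
Proof. by rewrite /bilin -!scalemxAl mxE. Qed.

Lemma bilinZr n (G : 'M[R]_n) a (u v : 'rV[R]_n) :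
  bilin G u (a *: v) = a * bilin G u v.
Proof. by rewrite /bilin linearZ /= -!scalemxAr mxE. Qed.

Lemma bilin_sym n (G : 'M[R]_n) (u v : 'rV[R]_n) :
  G^T = G -> bilin G u v = bilin G v u.
Proof.
move=> GT; rewrite !bilinE exchange_big; apply: eq_bigr => i _.
by apply: eq_bigr => j _; rewrite -[in LHS]GT mxE mulrC mulrA mulrAC.
Qed.

(** A positive continuous function has a positive minimum on the compact unit
    sphere; homogeneity does the rest.  In dimension zero the sphere is empty. *)
Lemma bilin_lower n (G : 'M[R]_n) :
  (forall v : 'rV[R]_n, v != 0 -> 0 < bilin G v v) ->
  exists2 lam : R, 0 < lam & forall v, lam * `|v| ^+ 2 <= bilin G v v.
Proof.
move=> Gpos.
pose A := [set v : 'rV[R]_n | `|v| = 1].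
have [A0|A0] := pselect (A !=set0); last first.
  exists 1 => // v; have [->|v0] := eqVneq v 0.
    by rewrite normr0 expr0n mulr0 /bilin !mul0mx mxE.
  by exfalso; apply: A0; exists (`|v|^-1 *: v); exact: normfZV.
have cA : compact A.
  apply: bounded_closed_compact.
    by exists 1; split; [exact: num_real|move=> x x1 v /= ->; exact: ltW].
  rewrite (_ : A = (fun v => `|v|) @^-1` [set 1]) //.
  apply: preimage_closed; last exact: closed_eq.
  by move=> x _; exact: norm_continuous.
have cf : continuous (fun v : 'rV[R]_n => bilin G v v).
  move=> v; have cG : {for v, continuous (cst G : 'rV[R]_n -> 'M[R]_n)} by exact: cst_continuous.
  have cI : (fun w : 'rV[R]_n => w) @ v --> v by [].
  exact: (cvg_bilin cG cI cI).
have [w wA wmin] := EVT_min_rV A0 cA (continuous_subspaceT cf).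
have w1 : `|w| = 1 by move: wA; rewrite inE.
exists (bilin G w w).
  by apply: Gpos; rewrite -normr_gt0 w1.
move=> v; have [->|v0] := eqVneq v 0.
  by rewrite normr0 expr0n mulr0 /bilin !mul0mx mxE.
have vA : `|v|^-1 *: v \in A by rewrite inE; exact: normfZV.
have := wmin _ vA; rewrite bilinZl bilinZr mulrA -expr2 exprVn.
by rewrite ler_pdivlMl ?exprn_gt0 ?normr_gt0 // mulrC.
Qed.

Lemma is_derive_line (V : normedModType R) (x k : V) (e t : R) :
  is_derive t 1 (fun t : R => x + (e * t) *: k) (e *: k).
Proof.
have did : derivable (id : R -> R) t 1 by exact: derivable_id.
have dc : derivable (cst x : R -> V) t 1 by exact: derivable_cst.
have de : derivable (fun t : R => e * t) t 1.
  exact: derivableM (derivable_cst _ _ _) did.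
have [d E] := derive1Zl k de.
split; first exact: (derivableD dc d).
rewrite [LHS](deriveD dc d) derive_cst add0r -derive1E E.
by rewrite (derive1Ml e did) derive1_id mulr1.
Qed.

Lemma is_derive_coord (V : normedModType R) m n (f : V -> 'M[R]_(m, n))
    (x v : V) (df : 'M[R]_(m, n)) i j :
  is_derive x v f df -> is_derive x v (fun y => f y i j) (df i j).
Proof.
move=> [d <-]; split; first exact: ((derivable_mxP _ _ _).1 d).
by rewrite (derive_mx d) mxE.
Qed.

Lemma is_derive_along m n p (f : 'rV[R]_n -> 'M[R]_(m, p)) (x k : 'rV[R]_n) (t : R) :
  differentiable f (x + t *: k) ->
  is_derive t 1 (fun t0 : R => f (x + t0 *: k)) ('d f (x + t *: k) k).
Proof.
move=> df.
have dx : is_derive t 1 (fun t0 : R => x + t0 *: k) k.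
  have := is_derive_line x k 1 t; rewrite scale1r.
  by under eq_fun do rewrite mul1r.
have [d e] := dx; have [d' e'] := derive1_chain d df.
by split => //; rewrite -derive1E [LHS]e' derive1E e.
Qed.

(** The one-dimensional mean value theorem along the segment from [x] to [x + k],
    one matrix entry at a time, which loses nothing in the sup norm. *)
Lemma lipschitz_of_partials m n p (r B : R) (x0 : 'rV[R]_n)
    (f : 'rV[R]_n -> 'M[R]_(m, p)) : 0 <= B ->
  (forall x : 'rV[R]_n, `|x - x0| <= r -> differentiable f x) ->
  (forall (x : 'rV[R]_n) l, `|x - x0| <= r -> `|'D_(delta_mx 0 l) f x| <= B) ->
  forall x k : 'rV[R]_n, `|x - x0| <= r -> `|x + k - x0| <= r ->
  `|f (x + k) - f x| <= n%:R * B * `|k|.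
Proof.
move=> B0 df fB x k xr xkr.
have seg (t : R) : 0 <= t <= 1 -> `|x + t *: k - x0| <= r.
  move=> /andP[t0 t1].
  have -> : x + t *: k - x0 = (1 - t) *: (x - x0) + t *: (x + k - x0).
    by apply/matrixP => i j; rewrite !mxE; ring.
  rewrite (le_trans (ler_normD _ _))// !normrZ !ger0_norm ?subr_ge0 //.
  have -> : r = (1 - t) * r + t * r by ring.
  by rewrite lerD // ler_wpM2l // subr_ge0.
have chain t t01 := is_derive_along (df _ (seg t t01)).
apply: norm_le_coord; first by rewrite !mulr_ge0.
move=> i j.
pose q (t : R) := f (x + t *: k) i j.
have dq (t : R) : 0 <= t <= 1 -> is_derive t 1 q (('d f (x + t *: k) k) i j).
  by move=> t01; exact: is_derive_coord (chain t t01).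
have [||t t01] := @MVT_segment R q (fun t : R => ('d f (x + t *: k) k) i j) 0 1 ler01.
- move=> t; rewrite in_itv /= => /andP[t0 t1].
  by apply: dq; rewrite !ltW.
- apply: derivable_within_continuous => t; rewrite in_itv /= => t01.
  by have [] := dq t t01.
rewrite subr0 mulr1 /q scale1r scale0r addr0 !mxE => ->.
move: t01; rewrite in_itv /= => t01.
apply: le_trans (coord_le_norm _ _ _) _.
rewrite (diff_coords _ (df _ (seg t t01))).
rewrite (le_trans (ler_norm_sum _ _ _))//.
apply: (@le_trans _ _ (\sum_(l < n) `|k| * B)).
  apply: ler_sum => l _; rewrite normrZ ler_pM ?coord_le_norm //.
  exact/fB/seg.
by rewrite sumr_const card_ord -[leLHS]mulr_natl mulrA mulrAC.
Qed.

(** The function [t |-> f (x + t k) + f (x - t k)] has as derivative a first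
    difference of the partial derivatives of [f], to which the previous
    inequality applies: this gains the second factor [`|k|]. *)
Lemma second_difference m n p (r B : R) (x0 : 'rV[R]_n)
    (f : 'rV[R]_n -> 'M[R]_(m, p)) : 0 <= B ->
  (forall x : 'rV[R]_n, `|x - x0| <= r -> differentiable f x) ->
  (forall (x : 'rV[R]_n) i, `|x - x0| <= r -> differentiable ('D_(delta_mx 0 i) f) x) ->
  (forall (x : 'rV[R]_n) i l, `|x - x0| <= r ->
     `|'D_(delta_mx 0 l) ('D_(delta_mx 0 i) f) x| <= B) ->
  forall x k : 'rV[R]_n, `|x + k - x0| <= r -> `|x - k - x0| <= r ->
  `|f (x + k) + f (x - k) - (f x + f x)| <= 2 * n%:R ^+ 2 * B * `|k| ^+ 2.
Proof.
move=> B0 df ddf fB x k xkr xNkr.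
have seg (t : R) : -1 <= t <= 1 -> `|x + t *: k - x0| <= r.
  move=> /andP[t0 t1].
  have -> : x + t *: k - x0 = ((1 + t) / 2) *: (x + k - x0) + ((1 - t) / 2) *: (x - k - x0).
    by apply/matrixP => i j; rewrite !mxE; field.
  have p0 : 0 <= (1 + t) / 2 by lra.
  have q0 : 0 <= (1 - t) / 2 by lra.
  rewrite (le_trans (ler_normD _ _))// !mx_normZ (ger0_norm p0) (ger0_norm q0).
  have -> : r = (1 + t) / 2 * r + (1 - t) / 2 * r by field.
  by apply: lerD; exact: ler_wpM2l.
apply: norm_le_coord; first by rewrite !mulr_ge0.
move=> i j.
have segP (t : R) : 0 <= t <= 1 -> `|x + t *: k - x0| <= r.
  by move=> t01; apply: seg; lra.
have segN (t : R) : 0 <= t <= 1 -> `|x + t *: (- k) - x0| <= r.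
  by move=> t01; rewrite scalerN -scaleNr; apply: seg; lra.
pose q (t : R) := f (x + t *: k) i j + f (x + t *: (- k)) i j.
pose dq (t : R) := ('d f (x + t *: k) k) i j + ('d f (x + t *: (- k)) (- k)) i j.
have Dq (t : R) : 0 <= t <= 1 -> is_derive t 1 q (dq t).
  move=> t01.
  have D1 := is_derive_coord i j (is_derive_along (df _ (segP t t01))).
  have D2 := is_derive_coord i j (is_derive_along (df _ (segN t t01))).
  exact: (is_deriveD D1 D2).
have [||t] := @MVT_segment R q dq 0 1 ler01.
- move=> t; rewrite in_itv /= => /andP[t0 t1].
  by apply: Dq; rewrite !ltW.
- apply: derivable_within_continuous => t; rewrite in_itv /= => t01.
  by have [] := Dq t t01.
rewrite in_itv /= => t01; rewrite subr0 mulr1 => e.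
have -> : (f (x + k) + f (x - k) - (f x + f x)) i j = dq t.
  by rewrite -e /q !mxE !scale1r !scale0r !addr0.
have sg1 := segP t t01; have sg2 := segN t t01.
have dN y : 'd f y (- k) = - 'd f y k.
  by rewrite -scaleN1r linearZ /= scaleN1r.
have key (A B1 A' B1' : 'M[R]_(m, p)) : B1 = - B1' -> A = A' ->
    forall C, B1' = C -> A i j + B1 i j = (A' - C) i j.
  by move=> -> -> C ->; rewrite !mxE.
rewrite /dq; have -> := key _ _ _ _ (dN _) (diff_coords k (df _ sg1)) _ (diff_coords k (df _ sg2)).
apply: le_trans (coord_le_norm _ _ _) _.
rewrite -sumrB (le_trans (ler_norm_sum _ _ _))//.
apply: (@le_trans _ _ (\sum_(l < n) `|k| * (n%:R * B * (2 * `|k|)))).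
  apply: ler_sum => l _; rewrite -scalerBr normrZ ler_pM ?coord_le_norm //.
  have ek : x + t *: k = (x + t *: (- k)) + (2 * t) *: k.
    by apply/matrixP => a b; rewrite !mxE; ring.
  rewrite ek; apply: le_trans (@lipschitz_of_partials m n p r B x0 ('D_(delta_mx 0 l) f) B0 _ _ _ _ sg2 _) _.
  - by move=> y yr; exact: ddf.
  - by move=> y l' yr; exact: fB.
  - by rewrite -ek.
  rewrite ler_wpM2l ?mulr_ge0 // mx_normZ ger0_norm; last by lra.
  by apply: ler_wpM2r => //; lra.
rewrite sumr_const card_ord -[leLHS]mulr_natl le_eqVlt; apply/orP; left; apply/eqP.
by ring.
Qed.

End LocalBounds.

(** * Coordinate balls with uniform bounds on the metric *)

(** A single constant serves all the bounds.  Through [good_lower] the arc length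
    controls the displacement in coordinates; [good_second] is the one bound that
    uses second derivatives of the metric, and it produces the quadratic
    estimate on lengths. *)
Record good_ball (R : realType) (n : nat) (M : ptopologicalType)
    (S : smooth_structure R n M) (g : riemannian_metric S)
    (c : chart R n M) (x0 : 'rV[R]_n) (r K : R) : Prop := GoodBall {
  good_radius : 0 < r ;
  good_const : 1 <= K ;
  good_img : forall x : 'rV[R]_n, `|x - x0| <= r -> chart_img c x ;
  good_lower : forall x v : 'rV[R]_n, `|x - x0| <= r ->
    `|v| <= K * Num.sqrt (bilin (gram g c x) v v) ;
  good_upper : forall x u v : 'rV[R]_n, `|x - x0| <= r ->
    `|bilin (gram g c x) u v| <= K * `|u| * `|v| ;
  good_lipschitz : forall x k u v : 'rV[R]_n, `|x - x0| <= r -> `|x + k - x0| <= r ->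
    `|bilin (gram g c (x + k)) u v - bilin (gram g c x) u v| <=
    K * `|k| * `|u| * `|v| ;
  good_second : forall x k u v : 'rV[R]_n, `|x + k - x0| <= r -> `|x - k - x0| <= r ->
    `|bilin (gram g c (x + k)) u v + bilin (gram g c (x - k)) u v -
      2 * bilin (gram g c x) u v| <= K * `|k| ^+ 2 * `|u| * `|v|
}.

Section GoodBalls.
Context (R : realType) (n : nat) (M : ptopologicalType).
Context (S : smooth_structure R n M) (g : riemannian_metric S).

Lemma bilin_gram_ge0 (c : chart R n M) (x v : 'rV[R]_n) :
  atlas S c -> chart_img c x -> 0 <= bilin (gram g c x) v v.
Proof.
move=> ac ix; have [->|v0] := eqVneq v 0.
  by rewrite /bilin !mul0mx mxE.
exact: ltW (gram_pos g ac ix v0).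
Qed.

(** The lower bound holds at the centre by positivity, and persists nearby
    with half the constant by continuity. *)
Lemma near_lower_bound (f : 'rV[R]_n -> 'M[R]_n) (x0 : 'rV[R]_n) :
  {for x0, continuous f} ->
  (forall v : 'rV[R]_n, v != 0 -> 0 < bilin (f x0) v v) ->
  exists2 lam : R, 0 < lam & \forall x \near x0,
    forall v, lam * `|v| ^+ 2 <= bilin (f x) v v.
Proof.
move=> cf /bilin_lower[lam lam0 fl].
exists (lam / 2); first by rewrite divr_gt0.
have N0 : 0 < n%:R ^+ 2 + 1 :> R by rewrite ltr_wpDl ?exprn_ge0.
have e0 : 0 < lam / 2 / (n%:R ^+ 2 + 1) by rewrite !divr_gt0.
have /cvgrPdist_le /(_ _ e0) := cf; apply: filterS => x /= fx v.
have -> : f x = f x0 - (f x0 - f x) by rewrite opprB addrC subrK.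
rewrite bilinD bilinN.
have := fl v; have := ler_norm (bilin (f x0 - f x) v v).
have := bilin_norm (f x0 - f x) v v.
suff : n%:R ^+ 2 * `|f x0 - f x| * `|v| * `|v| <= lam / 2 * `|v| ^+ 2 by lra.
rewrite -mulrA -expr2 ler_wpM2r ?exprn_ge0 //.
apply: (@le_trans _ _ (n%:R ^+ 2 * (lam / 2 / (n%:R ^+ 2 + 1)))).
  by rewrite ler_wpM2l ?exprn_ge0.
by rewrite mulrCA ger_pMr ?divr_gt0 // ler_pdivrMr // mul1r lerDl.
Qed.

Lemma near_bounded_all (V W : normedModType R) (I : finType) (F : I -> V -> W) x0 :
  (forall i, {for x0, continuous (F i)}) ->
  exists2 B : R, 0 <= B & \forall x \near x0, forall i, `|F i x| <= B.
Proof.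
move=> cF; exists (\sum_i (`|F i x0| + 1)).
  by apply: sumr_ge0 => i _; rewrite addr_ge0.
have := @filter_forall V I (fun i x => is_true (`|F i x| <= `|F i x0| + 1)) (nbhs x0)
  (nbhs_filter x0).
move=> /(_ (fun i => near_norm_le (cF i))); apply: filterS => x Fx i.
apply: le_trans (Fx i) _; rewrite (bigD1 i) //= lerDl.
by apply: sumr_ge0 => j _; rewrite addr_ge0.
Qed.

(** The metric and its partial derivatives up to order two are finitely many
    continuous functions, hence bounded near [x0]. *)
Lemma near_good_ball (c : chart R n M) (x0 : 'rV[R]_n) :
  atlas S c -> chart_img c x0 -> exists r K, good_ball g c x0 r K.
Proof.
move=> ac ix0.
have [d0 c0] : Ck_on 1 (chart_img c) (gram g c) by exact: (gram_smooth g ac 1%N).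
have Sm : Ck_on 2 (chart_img c) (gram g c) by exact: (gram_smooth g ac 2%N).
have d1 (i : 'I_n) x : chart_img c x -> differentiable ('D_(delta_mx 0 i) (gram g c)) x.
  by move=> ix; have [_ /(_ (delta_mx 0 i))[+ _]] := Sm; apply.
have c2 (i l : 'I_n) : {for x0, continuous
    ('D_(delta_mx 0 l) ('D_(delta_mx 0 i) (gram g c)))}.
  by have [_ /(_ (delta_mx 0 i))[_ /(_ (delta_mx 0 l) x0)]] := Sm; apply.
have c1 (i : 'I_n) : {for x0, continuous ('D_(delta_mx 0 i) (gram g c))}.
  exact: (c0 _ _ ix0).
have cg : {for x0, continuous (gram g c)} by exact: gram_continuous.
have [lam lam0 nl] := near_lower_bound cg (fun v v0 => gram_pos g ac ix0 v0).
have ni : \forall x \near x0, chart_img c x.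
  by apply: open_nbhs_nbhs; split => //; exact: chart_img_open.
have [B1 B1_ge0 n1] := near_bounded_all c1.
have [B2 B2_ge0 n2] := near_bounded_all (fun i : 'I_n * 'I_n => c2 i.1 i.2).
have n0 := near_norm_le cg.
pose B0 := `|gram g c x0| + 1.
have : \forall x \near x0, [/\ chart_img c x,
    (forall v, lam * `|v| ^+ 2 <= bilin (gram g c x) v v),
    `|gram g c x| <= B0,
    (forall i : 'I_n, `|'D_(delta_mx 0 i) (gram g c) x| <= B1) &
    (forall i l : 'I_n, `|'D_(delta_mx 0 l) ('D_(delta_mx 0 i) (gram g c)) x| <= B2)].
  near=> x; split; [by near: x|by near: x|by near: x|by near: x|].
  move=> i l; have : forall i : 'I_n * 'I_n,
      `|'D_(delta_mx 0 i.2) ('D_(delta_mx 0 i.1) (gram g c)) x| <= B2 by near: x.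
  by move=> /(_ (i, l)).
move=> /nbhs_closedballP[e he]; pose r := e%:num.
have {}he (x : 'rV[R]_n) : `|x - x0| <= r -> [/\ chart_img c x,
    (forall v, lam * `|v| ^+ 2 <= bilin (gram g c x) v v),
    `|gram g c x| <= B0,
    (forall i : 'I_n, `|'D_(delta_mx 0 i) (gram g c) x| <= B1) &
    (forall i l : 'I_n, `|'D_(delta_mx 0 l) ('D_(delta_mx 0 i) (gram g c)) x| <= B2)].
  by move=> xr; apply: he; rewrite closed_ballE // /closed_ball_ /= distrC.
have dg (x : 'rV[R]_n) : `|x - x0| <= r -> differentiable (gram g c) x.
  by move=> /he[ix _ _ _ _]; exact: d0.
have ddg (x : 'rV[R]_n) (i : 'I_n) :
    `|x - x0| <= r -> differentiable ('D_(delta_mx 0 i) (gram g c)) x.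
  by move=> /he[ix _ _ _ _]; exact: d1.
have bd1 (x : 'rV[R]_n) (i : 'I_n) :
    `|x - x0| <= r -> `|'D_(delta_mx 0 i) (gram g c) x| <= B1.
  by move=> /he[_ _ _ /(_ i) + _].
have bd2 (x : 'rV[R]_n) (i l : 'I_n) : `|x - x0| <= r ->
    `|'D_(delta_mx 0 l) ('D_(delta_mx 0 i) (gram g c)) x| <= B2.
  by move=> /he[_ _ _ _ /(_ i l)].
pose N : R := n%:R ^+ 2; have N0 : 0 <= N by rewrite exprn_ge0.
pose K1 := (Num.sqrt lam)^-1; pose K2 := N * B0.
pose K3 := N * (n%:R * B1); pose K4 := N * (2 * N * B2).
have K1_ge0 : 0 <= K1 by rewrite invr_ge0 sqrtr_ge0.
have B0_ge0 : 0 <= B0 by rewrite addr_ge0.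
have K2_ge0 : 0 <= K2 by rewrite mulr_ge0.
have K3_ge0 : 0 <= K3 by rewrite !mulr_ge0.
have K4_ge0 : 0 <= K4 by rewrite !mulr_ge0.
exists r, (1 + K1 + K2 + K3 + K4); split.
- by rewrite /r.
- by lra.
- by move=> x /he[].
- move=> x v /he[_ /(_ v) xl _ _ _].
  apply: (@le_trans _ _ (K1 * Num.sqrt (bilin (gram g c x) v v))); last first.
    by rewrite ler_wpM2r ?sqrtr_ge0 //; lra.
  rewrite /K1 ler_pdivlMl ?sqrtr_gt0 // -[`|v|]ger0_norm // -sqrtr_sqr -sqrtrM ?(ltW lam0) //.
  exact: ler_wsqrtr.
- move=> x u v /he[_ _ xB _ _].
  apply: le_trans (bilin_norm _ _ _) _.
  rewrite ler_wpM2r // ler_wpM2r //.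
  apply: (@le_trans _ _ K2); last by lra.
  by rewrite ler_wpM2l.
- move=> x k u v xr xkr.
  rewrite -bilinN -bilinD; apply: le_trans (bilin_norm _ _ _) _.
  have := lipschitz_of_partials B1_ge0 dg bd1 xr xkr => L.
  rewrite ler_wpM2r // ler_wpM2r //.
  apply: (@le_trans _ _ (K3 * `|k|)); last by rewrite ler_wpM2r //; lra.
  by rewrite /K3 -mulrA ler_wpM2l.
- move=> x k u v xkr xNkr.
  have -> : bilin (gram g c (x + k)) u v + bilin (gram g c (x - k)) u v -
      2 * bilin (gram g c x) u v = bilin (gram g c (x + k) + gram g c (x - k) -
        (gram g c x + gram g c x)) u v.
    by rewrite !bilinD bilinN bilinD; ring.
  apply: le_trans (bilin_norm _ _ _) _.
  have := second_difference B2_ge0 dg ddg bd2 xkr xNkr => L.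
  rewrite ler_wpM2r // ler_wpM2r //.
  apply: (@le_trans _ _ (K4 * `|k| ^+ 2)); last by rewrite ler_wpM2r ?exprn_ge0 //; lra.
  by rewrite /K4 -[X in _ <= X]mulrA ler_wpM2l.
Unshelve. all: by end_near. Qed.

End GoodBalls.

(** * Lengths and the distance *)

(** Sealed, because comparing the lengths of two distinct curves up to
    conversion would unfold the Lebesgue integral. *)
HB.lock Definition curve_length (R : realType) (n : nat) (M : ptopologicalType)
    (S : smooth_structure R n M) (g : riemannian_metric S) (s : R -> M) : R :=
  \int[@lebesgue_measure R]_(t in `[0, 1]) speed g s t.

Section Distance.
Context (R : realType) (n : nat) (M : ptopologicalType).
Context (S : smooth_structure R n M) (g : riemannian_metric S).
Local Notation mu := (@lebesgue_measure R).

Lemma C1_segment_at (s : R -> M) (t : R) :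
  C1_segment S s -> 0 <= t <= 1 -> C1_curve_at S s t.
Proof.
move=> [U [oU sU CU]] t01; apply: (C1_curve_on_at oU CU).
by apply: sU; rewrite /= in_itv.
Qed.

Lemma continuous_unit_integrable (f : R -> R) :
  (forall t, 0 <= t <= 1 -> {for t, continuous f}) ->
  mu.-integrable `[0, 1] (EFin \o f).
Proof.
move=> cf; apply: continuous_compact_integrable; first exact: segment_compact.
apply: continuous_in_subspaceT => t; rewrite inE /= in_itv /=; exact: cf.
Qed.

Lemma speed_integrable (s : R -> M) :
  C1_segment S s -> mu.-integrable `[0, 1] (EFin \o speed g s).
Proof.
move=> Cs; apply: continuous_unit_integrable => t t01.
exact: speed_continuous (C1_segment_at Cs t01).
Qed.

Lemma measurable_unit : measurable (`[0, 1]%classic : set (measurableTypeR R)).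
Proof. exact: measurable_itv. Qed.

Lemma Rintegral_unit_cst (C : R) : \int[mu]_(t in `[0, 1]) C = C.
Proof.
rewrite (Rintegral_cst mu measurable_unit).
rewrite [X in fine X](_ : _ = 1%E) ?mulr1 //.
by apply: etrans (lebesgue_measure_itv `[0 : R, 1]) _; rewrite /= lte01 oppr0 adde0.
Qed.

Lemma cst_integrable (C : R) : mu.-integrable `[0, 1] (EFin \o (fun=> C : R)).
Proof. by apply: continuous_unit_integrable => t _; exact: cst_continuous. Qed.

Lemma length_le_of_speed_le (s : R -> M) (C : R) : C1_segment S s ->
  (forall t, 0 <= t <= 1 -> speed g s t <= C) ->
  curve_length g s <= C.
Proof.
move=> Cs sC; rewrite curve_length.unlock -[leRHS]Rintegral_unit_cst.
apply: (le_Rintegral measurable_unit (speed_integrable Cs) (cst_integrable C)) => t.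
by rewrite /= in_itv /=; exact: sC.
Qed.

Lemma curve_length_ge0 (s : R -> M) : 0 <= curve_length g s.
Proof.
by rewrite curve_length.unlock; apply: Rintegral_ge0 => t _; exact: speed_ge0.
Qed.

Lemma path_length_cons s l :
  path_length g (s :: l) = curve_length g s + path_length g l.
Proof. by rewrite /path_length big_cons curve_length.unlock. Qed.

Lemma path_length_nil : path_length g [::] = 0.
Proof. by rewrite /path_length big_nil. Qed.

Lemma path_length_ge0 l : 0 <= path_length g l.
Proof.
elim: l => [|s l IH]; first by rewrite path_length_nil.
by rewrite path_length_cons addr_ge0 // curve_length_ge0.
Qed.

Lemma piecewise_cat p q r l l' : piecewise_C1_path S p l q ->
  piecewise_C1_path S q l' r -> piecewise_C1_path S p (l ++ l') r.
Proof.
elim: l p => [p /= ->|s l IH p /= [Cs s0 sl] ql'] //.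
by split => //; exact: IH.
Qed.

(** The infimum over an empty set of lengths is zero, so the triangle inequality
    and its consequences only hold between points that some path connects. *)
Definition joined p q := exists l, piecewise_C1_path S p l q.

Lemma joined_trans q p r : joined p q -> joined q r -> joined p r.
Proof. by move=> [l pl] [l' ql]; exists (l ++ l'); exact: piecewise_cat ql. Qed.

Lemma joined_refl p : joined p p.
Proof. by exists [::]. Qed.

Lemma dist_has_lbound p q :
  has_lbound [set path_length g l | l in [set l | piecewise_C1_path S p l q]].
Proof. by exists 0 => _ [l _ <-]; exact: path_length_ge0. Qed.

Lemma dist_le_length p q l :
  piecewise_C1_path S p l q -> dist g p q <= path_length g l.
Proof. by move=> pl; apply: ge_inf; [exact: dist_has_lbound|exists l]. Qed.

Lemma dist_ge0 p q : 0 <= dist g p q.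
Proof.
have [A0|A0] := pselect ([set path_length g l | l in [set l | piecewise_C1_path S p l q]] !=set0).
  by apply: lb_le_inf => // _ [l _ <-]; exact: path_length_ge0.
by rewrite /dist inf_out // => -[].
Qed.

Lemma near_minimal_path p q (e : R) : joined p q -> 0 < e ->
  exists2 l, piecewise_C1_path S p l q & path_length g l < dist g p q + e.
Proof.
move=> [l pl] e0; have hi : has_inf [set path_length g l | l in [set l | piecewise_C1_path S p l q]].
  by split; [exists (path_length g l), l|exact: dist_has_lbound].
by have [_ [l' pl' <-] lt] := inf_adherent e0 hi; exists l'.
Qed.

Lemma path_length_cat l l' :
  path_length g (l ++ l') = path_length g l + path_length g l'.
Proof. by rewrite /path_length big_cat. Qed.

Lemma dist_triangle q p r : joined p q -> joined q r ->
  dist g p r <= dist g p q + dist g q r.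
Proof.
move=> pq qr; apply/ler_addgt0Pr => e e0.
have e20 : 0 < e / 2 by rewrite divr_gt0.
have [l pl ll] := near_minimal_path pq e20.
have [l' ql ll'] := near_minimal_path qr e20.
have := dist_le_length (piecewise_cat pl ql).
by rewrite path_length_cat; lra.
Qed.

Lemma line_C1 (x k : 'rV[R]_n) (t : R) : C1_at (fun t : R => x + t *: k) t.
Proof.
have d (u : R) : is_derive u 1 (fun t : R => x + t *: k) k.
  have := is_derive_line x k 1 u; rewrite scale1r.
  by under eq_fun do rewrite mul1r.
split; first by near=> u; have [] := d u.
have -> : derive1 (fun t : R => x + t *: k) = cst k.
  by apply/funext => u; rewrite derive1E; have [_ ->] := d u.
exact: cst_continuous.
Unshelve. all: by end_near. Qed.

Lemma line_derive1 (x k : 'rV[R]_n) (t : R) : derive1 (fun t : R => x + t *: k) t = k.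
Proof.
have := is_derive_line x k 1 t; rewrite scale1r => -[_].
by under eq_fun do rewrite mul1r; rewrite derive1E.
Qed.

Section Segments.
Variables (c : chart R n M) (x0 : 'rV[R]_n) (r K : R).
Hypotheses (ac : atlas S c) (G : good_ball g c x0 r K).

Lemma ball_segment (x y : 'rV[R]_n) (t : R) : 0 <= t <= 1 ->
  `|x - x0| <= r -> `|y - x0| <= r -> `|x + t *: (y - x) - x0| <= r.
Proof.
move=> t01 xr yr.
have -> : x + t *: (y - x) - x0 = (1 - t) *: (x - x0) + t *: (y - x0).
  by apply/matrixP => i j; rewrite !mxE; ring.
rewrite (le_trans (ler_normD _ _))// !mx_normZ !ger0_norm ?subr_ge0; [|lra..].
have -> : r = (1 - t) * r + t * r by ring.
by apply: lerD; apply: ler_wpM2l => //; lra.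
Qed.

(** Straight segments in coordinates bound the distance from above. *)
Lemma chart_segment (x y : 'rV[R]_n) : `|x - x0| <= r -> `|y - x0| <= r ->
  C1_segment S (fun t => chart_inv c (x + t *: (y - x))) /\
  curve_length g (fun t => chart_inv c (x + t *: (y - x))) <= K * `|y - x|.
Proof.
move=> xr yr; pose z (t : R) := x + t *: (y - x).
have inU (t : R) : 0 <= t <= 1 -> chart_img c (z t).
  by move=> t01; apply: (good_img G); exact: ball_segment.
have Cz (t : R) : C1_at z t by exact: line_C1.
have Cs : C1_segment S (chart_inv c \o z).
  exists (z @^-1` chart_img c); split.
  - apply: open_comp; last exact: chart_img_open.
    by move=> t _; exact: C1_at_continuous.
  - by move=> t; rewrite /= in_itv /=; exact: inU.
  - by apply: C1_curve_at_on => t Ut; exact: C1_curve_of_coords.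
split=> //; apply: length_le_of_speed_le => // t t01.
have iz := inU t t01.
have [cst Cst] := C1_segment_at Cs t01.
have dz : chart_dom c ((chart_inv c \o z) t) by exact: chart_invP.
have CE := Cst c ac dz.
have nz : {near t, chart_map c \o (chart_inv c \o z) =1 z}.
  have nU : \forall u \near t, chart_img c (z u).
    apply: (C1_at_continuous (Cz t)); apply: open_nbhs_nbhs; split => //.
    exact: chart_img_open.
  by apply: filterS nU => u iu; rewrite /= chart_invK.
rewrite (speed_chart g ac dz cst (C1_at_derivable CE)).
rewrite (near_eq_derive1 nz) line_derive1 (nbhs_singleton nz).
have K1 := good_const G.
have B := good_upper G (y - x) (y - x) (ball_segment t01 xr yr).
have K0 : 0 <= K * `|y - x| by rewrite mulr_ge0 //; lra.
rewrite -[leRHS]ger0_norm // -sqrtr_sqr ler_wsqrtr //.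
apply: le_trans (ler_norm _) (le_trans B _).
have := normr_ge0 (y - x); nra.
Qed.

Lemma chart_joined (x y : 'rV[R]_n) : `|x - x0| <= r -> `|y - x0| <= r ->
  joined (chart_inv c x) (chart_inv c y) /\
  dist g (chart_inv c x) (chart_inv c y) <= K * `|y - x|.
Proof.
move=> xr yr; have [Cs sl] := chart_segment xr yr.
have pl : piecewise_C1_path S (chart_inv c x)
    [:: fun t => chart_inv c (x + t *: (y - x))] (chart_inv c y).
  by split; [|rewrite scale0r addr0|rewrite /= scale1r addrC subrK].
split; first by exists [:: fun t => chart_inv c (x + t *: (y - x))].
apply: le_trans (dist_le_length pl) _.
by rewrite path_length_cons path_length_nil addr0.
Qed.

End Segments.

Lemma near_joined_dist (q : M) (e : R) : 0 < e -> \forall q' \near q,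
  [/\ joined q q', joined q' q, dist g q q' <= e & dist g q' q <= e].
Proof.
move=> e0; pose c := chart_at S q.
have ac : atlas S c by exact: chart_at_atlas.
have dq : chart_dom c q by exact: chart_at_dom.
have [r [K G]] := near_good_ball g ac (chart_mapP dq).
have K1 := good_const G; have r0 := good_radius G.
have K0 : 0 < K by lra.
have nd : \forall q' \near q, chart_dom c q'.
  by apply: open_nbhs_nbhs; split => //; exact: chart_dom_open.
have m0 : 0 < Num.min r (e / K) by rewrite lt_min r0 divr_gt0.
have /cvgrPdist_le /(_ _ m0) nm := chart_map_continuous dq.
near=> q'.
have dq' : chart_dom c q' by near: q'.
have : `|chart_map c q - chart_map c q'| <= Num.min r (e / K) by near: q'.
rewrite le_min => /andP[qr qe].
have q'r : `|chart_map c q' - chart_map c q| <= r by rewrite distrC.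
have qq : `|chart_map c q - chart_map c q| <= r by rewrite subrr normr0 ltW.
have [j1 d1] := chart_joined ac G qq q'r.
have [j2 d2] := chart_joined ac G q'r qq.
move: j1 d1 j2 d2; rewrite !chart_mapK // => j1 d1 j2 d2.
split=> //.
  by apply: le_trans d1 _; rewrite distrC mulrC -ler_pdivlMr.
by apply: le_trans d2 _; rewrite mulrC -ler_pdivlMr.
Unshelve. all: by end_near. Qed.

(** The points reachable from [p] form an open and closed set, since every point
    is joined in both directions to all of its neighbours. *)
Lemma connected_joined : connected [set: M] -> forall p q, joined p q.
Proof.
move=> cM p; pose B := [set q | joined p q].
suff BT : B = setT by move=> q; have : B q by rewrite BT.
apply: cM.
- by exists p; exact: joined_refl.
- exists B; last by rewrite setTI.
  rewrite openE => q pq; apply: filterS (near_joined_dist q ltr01) => q' [qq' _ _ _].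
  exact: joined_trans pq qq'.
- exists B; last by rewrite setTI.
  move=> q clq; have [q' [pq' [_ q'q _ _]]] := clq _ (near_joined_dist q ltr01).
  exact: joined_trans pq' q'q.
Qed.

Lemma dist_continuous p (conn : forall p q, joined p q) : continuous (dist g p).
Proof.
move=> q; apply/cvgrPdist_le => e e0.
apply: filterS (near_joined_dist q e0) => q' [_ _ d1 d2].
have := dist_triangle (conn p q) (conn q q').
have := dist_triangle (conn p q') (conn q' q).
rewrite ler_norml; lra.
Qed.

End Distance.

(** * Primitives and the cut-off function *)

Section Primitive.
Context (R : realType).
Local Notation mu := (@lebesgue_measure R).

Definition clamp01 (t : R) : R := Num.max 0 (Num.min t 1).

Lemma clamp01_itv t : 0 <= clamp01 t <= 1.
Proof. by rewrite /clamp01 le_max lexx ge_max ler01 ge_min lexx orbT. Qed.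

Lemma clamp01_id t : 0 <= t <= 1 -> clamp01 t = t.
Proof. by move=> /andP[t0 t1]; rewrite /clamp01 (min_l t1) (max_r t0). Qed.

Lemma clamp01_continuous : continuous clamp01.
Proof.
move=> t.
have c0 (a : R) : {for t, continuous (cst a : R -> R^o)} by exact: cst_continuous.
have ci : {for t, continuous (id : R -> R^o)} by exact: id.
exact: (continuous_max (c0 0) (continuous_min ci (c0 1))).
Qed.

(** Freezing the integrand outside the unit interval gives a primitive that is
    C1 on a neighbourhood of it. *)
Lemma primitive01 (f : R -> R) (a0 : R) :
  (forall t, 0 <= t <= 1 -> {for t, continuous f}) ->
  exists F : R -> R, [/\ F 0 = a0, F 1 = a0 + \int[mu]_(t in `[0, 1]) f t,
    forall t, (-1 : R) < t -> C1_at F t &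
    forall t, 0 <= t <= 1 -> derive1 F t = f t].
Proof.
move=> cf; pose fc t := f (clamp01 t).
have cfc : continuous fc.
  move=> t; have cft := cf _ (clamp01_itv t).
  exact: (cvg_comp _ _ (clamp01_continuous (x := t)) cft).
have ifc (a b : R) : mu.-integrable `[a, b] (EFin \o fc).
  apply: continuous_compact_integrable; first exact: segment_compact.
  exact: continuous_subspaceT.
have [J [JE dJ]] : exists J : R -> R, J 1 - J 0 = \int[mu]_(t in `[0, 1]) f t /\
    forall t, (-1 : R) < t -> derivable J t 1 /\ derive1 J t = fc t.
  exists (fun t => \int[mu]_(u in `[-1, t]) fc u); split; last first.
    move=> t t1; have tt1 : t < t + 1 by lra.
    exact: (continuous_FTC1_closed tt1 (ifc _ _) t1 (cfc t)).
  rewrite (@Rintegral_itvB _ fc (BLeft (-1)) (BRight 1)); last 3 first.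
  - exact: ifc.
  - by rewrite bnd_simp; lra.
  - by rewrite bnd_simp.
  rewrite Rintegral_itv_obnd_cbnd.
    apply: eq_Rintegral => t; rewrite inE /= in_itv /= => t01.
    by rewrite /fc clamp01_id.
  apply: integrableS (ifc 0 1) => //.
  by apply: subset_itvr; rewrite bnd_simp.
pose F (t : R) := J t + (a0 - J 0).
have dF (t : R) : (-1 : R) < t -> derivable F t 1 /\ derive1 F t = fc t.
  move=> t1; have [d e] := dJ t t1.
  have dc : derivable (cst (a0 - J 0) : R -> R) t 1 by exact: derivable_cst.
  split; first exact: (derivableD d dc).
  by rewrite derive1E [LHS](deriveD d dc) derive_cst addr0 -derive1E.
have nF (t : R) : (-1 : R) < t -> \forall u \near t, -1 < u.
  by move=> t1; exact: lt_nbhsr.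
exists F; split.
- by rewrite /F addrC subrK.
- by rewrite /F -JE; ring.
- move=> t t1; split.
    by apply: filterS (nF t t1) => u u1; have [] := dF u u1.
  rewrite /prop_for /continuous_at (dF t t1).2.
  apply: cvg_trans (cfc t); apply: near_eq_cvg.
  by apply: filterS (nF t t1) => u u1; have [_ ->] := dF u u1.
- move=> t t01; have [|_ ->] := dF t; first by lra.
  by rewrite /fc clamp01_id.
Unshelve. all: by end_near. Qed.

(** Squaring the positive part makes the cut-off C1 at [rho], where it vanishes. *)
Definition cutoff (rho l : R) : R := Num.max 0 (1 - l / rho) ^+ 2.

Lemma derive_of_quadratic_error (f : R -> R) (t d C : R) :
  (forall u, `|f u - f t - d * (u - t)| <= C * (u - t) ^+ 2) ->
  is_derive t 1 f d.
Proof.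
move=> fC.
have cv : h^-1 *: (f (h *: (1 : R) + t) - f t) @[h --> 0^'] --> d.
  apply/cvgrPdist_le => e e0.
  have C0 : 0 <= C.
    by have := le_trans (normr_ge0 _) (fC (t + 1)); nra.
  have d0 : 0 < e / (C + 1) by rewrite divr_gt0 //; lra.
  near=> h.
  have h0 : h != 0 by near: h; exact: nbhs_dnbhs_neq.
  have hd : `|h| <= e / (C + 1) by near: h; exact: dnbhs0_le.
  rewrite [h *: 1]mulr1; have := fC (h + t); rewrite addrK => fh.
  have -> : d - h^-1 *: (f (h + t) - f t) = - (h^-1 * (f (h + t) - f t - d * h)).
    by rewrite /GRing.scale /=; field.
  rewrite normrN normrM normfV ler_pdivrMl ?normr_gt0 //.
  apply: le_trans fh _; rewrite -real_normK ?num_real // expr2 mulrA mulrC ler_wpM2l //.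
  apply: le_trans (_ : C * (e / (C + 1)) <= _); first by rewrite ler_wpM2l.
  rewrite mulrA ler_pdivrMr; [|lra].
  by rewrite mulrC ler_wpM2l //; [exact: ltW|lra].
split; first by apply/cvg_ex; exists d.
exact/cvg_lim.
Unshelve. all: by end_near. Qed.

Lemma cutoff_derive (rho l : R) : 0 < rho ->
  is_derive l 1 (cutoff rho) (- (2 / rho * Num.max 0 (1 - l / rho))).
Proof.
move=> r0; apply: (@derive_of_quadratic_error _ _ _ (rho^-1 ^+ 2)) => u.
rewrite /cutoff.
have -> : rho^-1 ^+ 2 * (u - l) ^+ 2 = ((1 - u / rho) - (1 - l / rho)) ^+ 2 by ring.
set a := 1 - u / rho; set b := 1 - l / rho.
have -> : - (2 / rho * Num.max 0 b) * (u - l) = 2 * Num.max 0 b * (a - b).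
  by rewrite /a /b; ring.
clearbody a b; have := sqr_ge0 (a - b).
rewrite ler_norml; case: (lerP 0 a) => a0; case: (lerP 0 b) => b0 ab0;
  apply/andP; split; nra.
Qed.

Lemma cutoff_C1 (rho l : R) : 0 < rho -> C1_at (cutoff rho) l.
Proof.
move=> r0; split; first by near=> u; have [] := cutoff_derive u r0.
have -> : derive1 (cutoff rho) = fun l => - (2 / rho * Num.max 0 (1 - l / rho)).
  by apply/funext => u; rewrite derive1E; have [_ ->] := cutoff_derive u r0.
have c0 (a : R) : {for l, continuous (cst a : R -> R^o)} by exact: cst_continuous.
have ci : {for l, continuous (id : R -> R^o)} by exact: id.
have c1 : {for l, continuous ((fun l : R => 1 - l / rho) : R -> R^o)}.
  by exact: (cvgB (c0 1) (cvgM ci (c0 rho^-1))).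
exact: (cvgN (cvgM (c0 (2 / rho)) (continuous_max (c0 0) c1))).
Unshelve. all: by end_near. Qed.

Lemma cutoff_itv (rho l : R) : 0 < rho -> 0 <= l -> 0 <= cutoff rho l <= 1.
Proof.
move=> r0 l0; have d0 : 0 <= l / rho by rewrite divr_ge0 // ltW.
rewrite /cutoff sqr_ge0 /= expr_le1 // ?le_max ?lexx // ge_max ler01 /=; lra.
Qed.

Lemma cutoff_eq0 (rho l : R) : 0 < rho -> rho <= l -> cutoff rho l = 0.
Proof.
move=> r0 rl; rewrite /cutoff max_l ?expr0n //.
by rewrite subr_le0 ler_pdivlMr // mul1r.
Qed.

Lemma cutoff0 (rho : R) : cutoff rho 0 = 1.
Proof. by rewrite /cutoff mul0r subr0 max_r ?ler01 // expr1n. Qed.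

Lemma cutoff_derive_le (rho l : R) : 0 < rho -> 0 <= l ->
  `|derive1 (cutoff rho) l| <= 2 / rho.
Proof.
move=> r0 l0; rewrite derive1E; have [_ ->] := cutoff_derive l r0.
have d0 : 0 <= l / rho by rewrite divr_ge0 // ltW.
have c0 : 0 < 2 / rho by rewrite divr_gt0.
have m0 : 0 <= Num.max 0 (1 - l / rho) by rewrite le_max lexx.
have m1 : Num.max 0 (1 - l / rho) <= 1 by rewrite ge_max ler01 /=; lra.
rewrite normrN ger0_norm; last by rewrite mulr_ge0 // ltW.
by rewrite ler_piMr // ltW.
Qed.

End Primitive.

(** * A curve stays in a coordinate ball while its arc length is small *)

Lemma is_derive_derive1 (R : realType) (V : normedModType R) (f : R -> V) (t : R) :
  derivable f t 1 -> is_derive t 1 f (derive1 f t).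
Proof. by move=> d; split; [exact: d|rewrite derive1E]. Qed.

Section Containment.
Context (R : realType) (n : nat) (M : ptopologicalType).
Context (S : smooth_structure R n M) (g : riemannian_metric S).
Context (hausdorffM : hausdorff_space M).
Variables (c : chart R n M) (x0 : 'rV[R]_n) (r K : R).
Hypotheses (ac : atlas S c) (G : good_ball g c x0 r K).

Definition in_ball (r' : R) (p : M) : Prop :=
  chart_dom c p /\ `|chart_map c p - x0| <= r'.

(** The image of a compact coordinate ball is compact, hence closed because the
    manifold is Hausdorff. *)
Lemma in_ball_closed r' : r' <= r -> closed (in_ball r').
Proof.
move=> r'r; pose B := [set x : 'rV[R]_n | `|x - x0| <= r'].
have -> : in_ball r' = chart_inv c @` B.
  apply/seteqP; split => [p [dp pr]|_ [x xr <-]].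
    by exists (chart_map c p) => //; rewrite chart_mapK.
  have ix : chart_img c x by apply: (good_img G); exact: le_trans r'r.
  by split; [exact: chart_invP|rewrite chart_invK].
apply: compact_closed => //; apply: continuous_compact.
  apply: continuous_in_subspaceT => x; rewrite inE => xr.
  apply: chart_inv_continuous; apply: (good_img G); exact: le_trans r'r.
have cd : continuous (fun x : 'rV[R]_n => `|x - x0|).
  move=> x; have cI : {for x, continuous (fun w : 'rV[R]_n => w)} by exact: id.
  have c0 : {for x, continuous (cst x0 : 'rV[R]_n -> 'rV[R]_n)} by exact: cst_continuous.
  exact: (cvg_norm (cvgB cI c0)).
apply: bounded_closed_compact.
  exists (r' + `|x0|); split; first exact: num_real.
  move=> b rb x /= xr; apply: le_trans (ltW rb).
  by rewrite -[x](subrK x0) (le_trans (ler_normD _ _))// lerD2r.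
rewrite (_ : B = (fun x => `|x - x0|) @^-1` [set t | t <= r']) //.
by apply: preimage_closed; [move=> x _; exact: cd|exact: closed_le].
Qed.

(** In the sup norm each coordinate is controlled by the arc length through
    the one-dimensional mean value theorem. *)
Lemma coord_displacement (s : R -> M) (ell : R -> R) (t : R) : 0 <= t <= 1 ->
  (forall u, 0 <= u <= t -> C1_curve_at S s u /\ in_ball r (s u)) ->
  (forall u, 0 <= u <= t -> derivable ell u 1 /\ speed g s u <= derive1 ell u) ->
  `|chart_map c (s t) - chart_map c (s 0)| <= K * (ell t - ell 0).
Proof.
move=> /andP[t0 t1] sB dell; pose x := chart_map c \o s.
have K1 := good_const G.
have dx u : 0 <= u <= t -> derivable x u 1 /\ `|derive1 x u| <= K * derive1 ell u.
  move=> u0t; have [[cs Cs] [du xr]] := sB u u0t.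
  have dxu := C1_at_derivable (Cs c ac du).
  split => //; apply: le_trans (good_lower G _ xr) _.
  rewrite ler_wpM2l //; first by lra.
  by rewrite -(speed_chart g ac du cs dxu); exact: (dell u u0t).2.
have key (e : R) (i : 'I_n) : `|e| = 1 -> 0 <= K * (ell t - ell 0) - e * (x t 0 i - x 0 0 i).
  move=> e1; pose f (u : R) := K * ell u - e * x u 0 i.
  pose df (u : R) := K * derive1 ell u - e * derive1 x u 0 i.
  have Df u : 0 <= u <= t -> is_derive u 1 f (df u).
    move=> u0t; have [d1 _] := dell u u0t; have [d2 _] := dx u u0t.
    have D1 := is_derive_derive1 d1.
    have D2 := is_derive_derive1 d2.
    exact: (is_deriveB (is_deriveZ K D1) (is_deriveZ e (is_derive_coord 0 i D2))).
  have -> : K * (ell t - ell 0) - e * (x t 0 i - x 0 0 i) = f t - f 0.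
    by rewrite /f; ring.
  have [||u u0t ->] := @MVT_segment R f df 0 t t0.
  - move=> u; rewrite in_itv /= => /andP[u0 ut].
    by apply: Df; rewrite !ltW.
  - apply: derivable_within_continuous => u; rewrite in_itv /= => u0t.
    by have [] := Df u u0t.
  move: u0t; rewrite in_itv /= => u0t; rewrite subr0 mulr_ge0 // subr_ge0.
  have [_ le] := dx u u0t; apply: le_trans le; apply: le_trans (ler_norm _) _.
  by rewrite normrM e1 mul1r; exact: coord_le_norm.
have E0 : 0 <= K * (ell t - ell 0).
  have t0t : 0 <= t <= t by rewrite t0 lexx.
    rewrite mulr_ge0 //; first by lra.
  have [||u u0t ->] := @MVT_segment R ell (derive1 ell) 0 t t0.
  - move=> u; rewrite in_itv /= => /andP[u0 ut].
    have [|d _] := dell u; first by rewrite !ltW.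
    exact: is_derive_derive1.
  - apply: derivable_within_continuous => u; rewrite in_itv /= => u0t.
    by have [] := dell u u0t.
  move: u0t; rewrite in_itv /= => u0t; rewrite subr0 mulr_ge0 //.
  by have [_] := dell u u0t; apply: le_trans; exact: speed_ge0.
apply: norm_le_coord => // a i; rewrite ord1 !mxE ler_norml -/(x t) -/(x 0).
have := key 1 i (normr1 _); have := key (-1) i; rewrite normrN1 => /(_ erefl).
by rewrite /x /=; lra.
Qed.

Lemma arc_nondecreasing (s : R -> M) (ell : R -> R) :
  (forall u, 0 <= u <= 1 -> derivable ell u 1 /\ speed g s u <= derive1 ell u) ->
  forall u v, 0 <= u -> u <= v -> v <= 1 -> ell u <= ell v.
Proof.
move=> dell u v u0 uv v1; rewrite -subr_ge0.
have [||w w0t ->] := @MVT_segment R ell (derive1 ell) u v uv.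
- move=> w; rewrite in_itv /= => /andP[w0 wt].
  have [|d _] := dell w; first by lra.
  exact: is_derive_derive1.
- apply: derivable_within_continuous => w; rewrite in_itv /= => w0t.
  by have [|//] := dell w; lra.
move: w0t; rewrite in_itv /= => w0t; rewrite mulr_ge0 ?subr_ge0 //.
by have [|_] := dell w; [lra|apply: le_trans; exact: speed_ge0].
Qed.

(** A curve cannot leave the coordinate ball before its arc length allows it:
    at the first exit time the curve would still lie in a smaller closed ball,
    whose image is closed in the Hausdorff space [M]. *)
Lemma containment (s : R -> M) (ell : R -> R) (rho : R) :
  K * rho < r ->
  (forall u, 0 <= u <= 1 -> C1_curve_at S s u) ->
  (forall u, 0 <= u <= 1 -> derivable ell u 1 /\ speed g s u <= derive1 ell u) ->
  (ell 0 <= rho -> in_ball (K * ell 0) (s 0)) ->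
  forall t, 0 <= t <= 1 -> ell t <= rho -> in_ball (K * ell t) (s t).
Proof.
move=> Kr Cs dell in0 T T01 eT.
have K1 := good_const G.
have mono := arc_nondecreasing dell.
have /in0[d0 b0] : ell 0 <= rho.
  by apply: le_trans eT; apply: mono; lra.
pose O := [set p | chart_dom c p /\ `|chart_map c p - x0| < r].
have oO : open O.
  rewrite openE => p [dp pr].
  have nd : \forall q \near p, chart_dom c q.
    by apply: open_nbhs_nbhs; split => //; exact: chart_dom_open.
  have nr : \forall q \near p, `|chart_map c q - x0| < r.
    have cd : `|chart_map c q - x0| @[q --> p] --> `|chart_map c p - x0|.
      have c0 : {for p, continuous (cst x0 : M -> 'rV[R]_n)} by exact: cst_continuous.
      exact: (cvg_norm (cvgB (chart_map_continuous dp) c0)).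
    exact: (cvgr_lt _ cd).
  by near=> q; split; near: q.
have step t : 0 <= t <= T -> (forall u, 0 <= u <= t -> O (s u)) -> in_ball (K * ell t) (s t).
  move=> t0T Ot; have [|dt _] := Ot t; first by lra.
  split => //.
  have D : `|chart_map c (s t) - chart_map c (s 0)| <= K * (ell t - ell 0).
    apply: coord_displacement; first by lra.
      move=> u u0t; split; first by apply: Cs; lra.
      by have [du ur] := Ot u u0t; split => //; exact: ltW.
    by move=> u u0t; apply: dell; lra.
  rewrite -(subrK (chart_map c (s 0)) (chart_map c (s t))) -addrA.
  by apply: le_trans (ler_normD _ _) _; lra.
suff allO : forall u, 0 <= u <= T -> O (s u) by apply: step => //; lra.
apply: contrapT => /existsNP[w /not_implyP[w0T nOw]].
(* [tau] is the first time at which the curve is outside the open ball. *)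
pose N := [set t | 0 <= t <= T /\ ~ O (s t)].
have hN : has_inf N.
  by split; [exists w|exists 0 => t [/andP[]]].
pose tau := inf N.
have tau0 : 0 <= tau by apply: lb_le_inf; [exists w|move=> t [/andP[]]].
have tauw : tau <= w by apply: ge_inf; [exact: hN.2|].
have Obefore u : 0 <= u -> u < tau -> O (s u).
  move=> u0 ut; apply: contrapT => nO.
  have : tau <= u by apply: ge_inf; [exact: hN.2|split => //; lra].
  lra.
have Cstau : {for tau, continuous s} by have [|] := Cs tau; [lra|].
have nOtau : ~ O (s tau).
  move=> Otau; have nO : \forall u \near tau, O (s u).
    by apply: Cstau; apply: open_nbhs_nbhs.
  have /nbhs_ballP[e /= e0 eO] := nO.
  have [t [t0T nOt] tlt] := inf_adherent e0 hN.
  have taut : tau <= t by apply: ge_inf; [exact: hN.2|].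
  by apply: nOt; apply: eO; rewrite /ball /= ltr_norml; lra.
have Kel t : 0 <= t <= T -> K * ell t <= K * rho.
  move=> t0T; rewrite ler_wpM2l //; first by lra.
  by apply: le_trans eT; apply: mono; lra.
have inside u : 0 <= u -> u < tau -> in_ball (K * rho) (s u).
  move=> u0 ut; have [d b] : in_ball (K * ell u) (s u).
    apply: step; first by lra.
    by move=> v v0u; apply: Obefore; lra.
  by split => //; apply: le_trans b (Kel _ _); lra.
(* At [tau] the curve is a limit of points of the smaller closed ball. *)
have [tau_gt0|tau_le0] := ltP 0 tau; last first.
  apply: nOtau; have -> : tau = 0 by lra.
  split => //; apply: le_lt_trans b0 _; apply: le_lt_trans Kr; apply: Kel; lra.
apply: nOtau.
suff [dt bt] : in_ball (K * rho) (s tau).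
  by split => //; apply: le_lt_trans Kr.
apply: contrapT => nin.
have nC : nbhs (s tau) (~` in_ball (K * rho)).
  apply: open_nbhs_nbhs; split => //.
  by apply: closed_openC; apply: in_ball_closed; exact: ltW.
have nn : \forall u \near tau, ~ in_ball (K * rho) (s u) := Cstau _ nC.
have /nbhs_ballP[e /= e0 en] := nn.
pose m := Num.min tau e / 2.
have m0 : 0 < Num.min tau e by rewrite lt_min tau_gt0.
have mt : Num.min tau e <= tau by rewrite ge_min lexx.
have me : Num.min tau e <= e by rewrite ge_min lexx orbT.
apply: (en (tau - m)); last by apply: inside; rewrite /m; lra.
by rewrite /ball /= ltr_norml /m; lra.
Unshelve. all: by end_near. Qed.

End Containment.

(** * Perturbing the beginning of a curve *)

Section Perturbation.
Context (R : realType) (n : nat) (M : ptopologicalType).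
Context (S : smooth_structure R n M) (g : riemannian_metric S).
Local Notation lebesgue := (@lebesgue_measure R).

Lemma C1_at_comp1 (f ell : R -> R) (t : R) :
  C1_at ell t -> (forall l, C1_at f l) ->
  C1_at (f \o ell) t /\ derive1 (f \o ell) t = derive1 f (ell t) * derive1 ell t.
Proof.
move=> Ct Cf; have [dl cl] := Ct.
have df l := C1_at_derivable (Cf l).
have E : \forall u \near t, derive1 (f \o ell) u = derive1 f (ell u) * derive1 ell u.
  by apply: filterS dl => u dlu; exact: (derive1_comp dlu (df (ell u))).
split; last exact: nbhs_singleton E.
split.
  by apply: filterS dl => u dlu; exact: (derive1_chain dlu ((derivable1_diffP _ _).1 (df (ell u)))).1.
rewrite /prop_for /continuous_at (nbhs_singleton E).
apply: (@cvg_trans _ ((fun u => derive1 f (ell u) * derive1 ell u) @ t)).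
  by apply: near_eq_cvg; apply: filterS E => u; exact: esym.
have cfl : derive1 f (ell u) @[u --> t] --> derive1 f (ell t).
  exact: (cvg_comp _ _ (C1_at_continuous Ct) (Cf (ell t)).2).
exact: (cvgM cfl cl).
Qed.

Lemma C1_segment_of_near (s : R -> M) :
  (forall t : R, 0 <= t <= 1 -> \forall u \near t, C1_curve_at S s u) ->
  C1_segment S s.
Proof.
move=> ns; exists (interior [set u | C1_curve_at S s u]); split.
- exact: open_interior.
- by move=> t; rewrite /= in_itv /= => t01; exact: ns.
- by apply: C1_curve_at_on => t; exact: interior_subset.
Qed.

Lemma C1_segment_near (s : R -> M) (t : R) : C1_segment S s -> 0 <= t <= 1 ->
  \forall u \near t, C1_curve_at S s u.
Proof.
move=> [U [oU sU CU]] t01.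
have nU : \forall u \near t, U u.
  by apply: open_nbhs_nbhs; split => //; apply: sU; rewrite /= in_itv.
by apply: filterS nU => u; exact: C1_curve_on_at.
Qed.

Lemma speed_of_coords (c : chart R n M) (s : R -> M) (y : R -> 'rV[R]_n) (t : R) :
  atlas S c -> C1_at y t -> chart_img c (y t) ->
  {near t, s =1 chart_inv c \o y} ->
  speed g s t = Num.sqrt (bilin (gram g c (y t)) (derive1 y t) (derive1 y t)).
Proof.
move=> ac Cy iy sy.
have ys : {near t, chart_inv c \o y =1 s} by apply: filterS sy => u; exact: esym.
have Cs := near_eq_C1_curve_at ys (C1_curve_of_coords ac iy Cy).
have est := nbhs_singleton sy.
have ds : chart_dom c (s t) by rewrite est; exact: chart_invP.
have nU : \forall u \near t, chart_img c (y u).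
  by apply: (C1_at_continuous Cy); apply: open_nbhs_nbhs; split => //; exact: chart_img_open.
have nz : {near t, chart_map c \o s =1 y}.
  by near=> u; rewrite /= (near sy u) //= chart_invK //; near: u.
rewrite (speed_chart g ac ds Cs.1 (C1_at_derivable (Cs.2 c ac ds))).
by rewrite (near_eq_derive1 nz) (nbhs_singleton nz).
Unshelve. all: by end_near. Qed.

Lemma near_eq_speed (s s' : R -> M) (t : R) : C1_curve_at S s t ->
  {near t, s' =1 s} -> speed g s' t = speed g s t.
Proof.
move=> [cs Cs] e; pose c := chart_at S (s t).
have ac : atlas S c by exact: chart_at_atlas.
have ds : chart_dom c (s t) by exact: chart_at_dom.
have sE := near_chart_comp cs ds.
have s'E : {near t, s' =1 chart_inv c \o (chart_map c \o s)}.
  by near=> u; rewrite (near e u) //; near: u.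
by rewrite (speed_of_coords ac (Cs c ac ds) (chart_mapP ds) s'E)
  (speed_of_coords ac (Cs c ac ds) (chart_mapP ds) sE).
Unshelve. all: by end_near. Qed.

(** Allows to replace a sum of two speeds by a sum of squared norms, in which the
    terms linear in the perturbation cancel. *)
Lemma sqrt_le_mean (b sigma : R) : 0 <= b -> 0 < sigma ->
  Num.sqrt b <= (b / sigma + sigma) / 2.
Proof.
move=> b0 s0; have s2 := sqr_ge0 (Num.sqrt b - sigma).
rewrite ler_pdivlMr // -(ler_pM2r s0) mulrDl divfK ?gt_eqF //.
by move: s2; rewrite sqrrB sqr_sqrtr //; lra.
Qed.

Section Fixed.
Variables (c : chart R n M) (x0 : 'rV[R]_n) (r K : R).
Hypotheses (ac : atlas S c) (G : good_ball g c x0 r K).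

Lemma mul3_le (A B C A' B' C' : R) : 0 <= A -> 0 <= B -> 0 <= C ->
  A <= A' -> B <= B' -> C <= C' -> A * B * C <= A' * B' * C'.
Proof.
move=> A0 B0 C0 AA BB CC; apply: ler_pM => //; first exact: mulr_ge0.
exact: ler_pM.
Qed.

(** Here [x] and [v] are the position and velocity of a curve in the chart, [w] its
    speed, and [k], [m] those of the perturbation.  The terms odd in [(k, m)] of
    the two squared norms cancel up to a Lipschitz error of the metric, and the
    even ones leave its second difference; all errors are of order [a ^ 2]. *)
Lemma speed_pair_bound (x v k m : 'rV[R]_n) (w sigma a : R) :
  `|x - x0| <= r -> `|x + k - x0| <= r -> `|x - k - x0| <= r ->
  w = Num.sqrt (bilin (gram g c x) v v) -> w <= sigma -> 0 < sigma -> 0 <= a ->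
  `|k| <= a -> `|m| <= 2 * a * sigma ->
  Num.sqrt (bilin (gram g c (x + k)) (v + m) (v + m)) +
  Num.sqrt (bilin (gram g c (x - k)) (v - m) (v - m)) <=
  w + sigma + 9 * K ^+ 3 * a ^+ 2 * sigma.
Proof.
move=> xr xpr xmr wE ws s0 a0 ka ma.
have K1 := good_const G.
have [ix ip im] := And3 (good_img G xr) (good_img G xpr) (good_img G xmr).
set bp := bilin (gram g c (x + k)) (v + m) (v + m).
set bm := bilin (gram g c (x - k)) (v - m) (v - m).
have bp0 : 0 <= bp by exact: bilin_gram_ge0.
have bm0 : 0 <= bm by exact: bilin_gram_ge0.
have w0 : 0 <= w by rewrite wE sqrtr_ge0.
have w2 : w ^+ 2 = bilin (gram g c x) v v by rewrite wE sqr_sqrtr // bilin_gram_ge0.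
have vK : `|v| <= K * sigma.
  apply: le_trans (good_lower G v xr) _; rewrite -wE ler_wpM2l //; lra.
have L (u u' : 'rV[R]_n) : bilin (gram g c (x + k)) u u' - bilin (gram g c (x - k)) u u' <= 2 * K * `|k| * `|u| * `|u'|.
  have := good_lipschitz G u u' xr xpr; have := good_lipschitz G u u' xr xmr.
  by rewrite normrN !ler_norml => /andP[A1 A2] /andP[A3 A4]; lra.
have D2 := ler_normlP _ _ (good_second G v v xpr xmr).
have Bp := ler_normlP _ _ (good_upper G m m xpr).
have Bm := ler_normlP _ _ (good_upper G m m xmr).
have e : bp + bm = (bilin (gram g c (x + k)) v v + bilin (gram g c (x - k)) v v)
   + (bilin (gram g c (x + k)) v m - bilin (gram g c (x - k)) v m)
   + (bilin (gram g c (x + k)) m v - bilin (gram g c (x - k)) m v)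
   + (bilin (gram g c (x + k)) m m + bilin (gram g c (x - k)) m m).
  rewrite /bp /bm -[- m]scaleN1r !(bilinDl, bilinDr, bilinZl, bilinZr); ring.
have as0 : 0 <= a * sigma by rewrite mulr_ge0 // ltW.
have k0 := normr_ge0 k; have m0 := normr_ge0 m; have v0 := normr_ge0 v.
have T1 : K * `|k| ^+ 2 * `|v| * `|v| <= K ^+ 3 * (a * sigma) ^+ 2.
  have -> : K ^+ 3 * (a * sigma) ^+ 2 = K * a ^+ 2 * (K * sigma) * (K * sigma) by ring.
  have kk : K * `|k| ^+ 2 <= K * a ^+ 2.
    by rewrite ler_wpM2l //; [lra|rewrite ler_pXn2r // ?nnegrE].
  have kk0 : 0 <= K * `|k| ^+ 2 by rewrite mulr_ge0 ?exprn_ge0 //; lra.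
  exact: mul3_le.
have T2 : K * `|m| * `|m| <= 4 * K * (a * sigma) ^+ 2.
  have -> : 4 * K * (a * sigma) ^+ 2 = K * (2 * a * sigma) * (2 * a * sigma) by ring.
  have kk0 : 0 <= K * `|m| by rewrite mulr_ge0 //; lra.
  by apply: mul3_le => //; lra.
have T3 : 2 * K * `|k| * `|v| * `|m| <= 4 * K ^+ 2 * (a * sigma) ^+ 2.
  have -> : 4 * K ^+ 2 * (a * sigma) ^+ 2 = 2 * K * a * (K * sigma) * (2 * a * sigma) by ring.
  have kk0 : 0 <= 2 * K * `|k| by rewrite mulr_ge0 //; lra.
  have kk1 : 2 * K * `|k| <= 2 * K * a by rewrite ler_wpM2l //; lra.
  exact: mul3_le.
have Lvm := L v m; have Lmv := L m v.
have {Lmv}Lmv : bilin (gram g c (x + k)) m v - bilin (gram g c (x - k)) m v <=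
   2 * K * `|k| * `|v| * `|m| by apply: le_trans Lmv _; rewrite mulrAC.
have KK : K <= K ^+ 2 /\ K ^+ 2 <= K ^+ 3 by split; nra.
have q0 := sqr_ge0 (a * sigma).
have S1 : bp + bm <= 2 * w ^+ 2 + 17 * K ^+ 3 * (a * sigma) ^+ 2.
  rewrite e w2; move: KK => [KK1 KK2].
  have R1 : K * (a * sigma) ^+ 2 <= K ^+ 3 * (a * sigma) ^+ 2.
    by rewrite ler_wpM2r //; lra.
  have R2 : K ^+ 2 * (a * sigma) ^+ 2 <= K ^+ 3 * (a * sigma) ^+ 2.
    by rewrite ler_wpM2r.
  by move: D2 Bp Bm => [_ D2] [_ Bp] [_ Bm]; lra.
have Mp := sqrt_le_mean bp0 s0; have Mm := sqrt_le_mean bm0 s0.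
have S2 : bp / sigma + bm / sigma <= 2 * w + 17 * K ^+ 3 * a ^+ 2 * sigma.
  rewrite -mulrDl ler_pdivrMr //; apply: le_trans S1 _.
  have : w ^+ 2 <= w * sigma by rewrite expr2 ler_wpM2l.
  by rewrite exprMn; lra.
have K3 : 0 <= K ^+ 3 by apply: exprn_ge0; lra.
have := mulr_ge0 (mulr_ge0 K3 (sqr_ge0 a)) (ltW s0); lra.
Qed.

(** A point [p] reached after arc length [l] is shifted in the chart by the fraction
    [cutoff rho l] of [h]; from arc length [rho] on, points stay where they are,
    so a whole path keeps its end point while its origin moves by [h]. *)
Definition perturb (rho : R) (h : 'rV[R]_n) (l : R) (p : M) : M :=
  if l < rho then chart_inv c (chart_map c p + cutoff rho l *: h) else p.

Lemma perturb_dom rho h l p : 0 < rho -> chart_dom c p ->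
  perturb rho h l p = chart_inv c (chart_map c p + cutoff rho l *: h).
Proof.
move=> r0 dp; rewrite /perturb; case: ltP => // rl.
by rewrite cutoff_eq0 // scale0r addr0 chart_mapK.
Qed.

Section Curve.
Variables (rho : R) (h : 'rV[R]_n) (s : R -> M) (ell : R -> R).
Hypotheses (rho0 : 0 < rho) (Cs : C1_segment S s).
Hypothesis Cell : forall t, (-1 : R) < t -> C1_at ell t.

Let s' (t : R) := perturb rho h (ell t) (s t).
Let y (t : R) := chart_map c (s t) + cutoff rho (ell t) *: h.

Lemma perturbed_coords_C1 t : (-1 : R) < t -> C1_curve_at S s t ->
  chart_dom c (s t) -> C1_at y t /\
  derive1 y t = derive1 (chart_map c \o s) t +
    (derive1 (cutoff rho) (ell t) * derive1 ell t) *: h.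
Proof.
move=> t1 [_ Cst] dt; have Cx := Cst c ac dt.
have [Ck Ek] := C1_at_comp1 (Cell t1) (fun l => cutoff_C1 l rho0).
have [dk ek] := derive1Zl h (C1_at_derivable Ck).
split; first exact: (C1_atD Cx (C1_atZl h Ck)).
by rewrite -Ek -ek !derive1E; exact: (deriveD (C1_at_derivable Cx) dk).
Qed.

Lemma perturbed_near_coords t : C1_curve_at S s t -> chart_dom c (s t) ->
  {near t, s' =1 chart_inv c \o y}.
Proof.
move=> Ct dt; apply: filterS (near_chart_dom Ct.1 dt) => u du.
exact: perturb_dom.
Qed.

Lemma perturbed_near_far t : (-1 : R) < t -> rho < ell t -> {near t, s' =1 s}.
Proof.
move=> t1 rl; have nr : \forall u \near t, rho < ell u.
  exact: (C1_at_continuous (Cell t1) (lt_nbhsr rl)).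
apply: filterS nr => u ru; rewrite /s' /perturb ltNge (ltW ru) //.
Qed.

(** Two germs cover the unit interval: where the arc length is at most [rho] the
    perturbed curve is read in the chart, and beyond [rho] it is the given one.
    They agree where both apply because the cut-off vanishes there. *)
Lemma perturbed_C1_segment :
  (forall t, 0 <= t <= 1 -> ell t <= rho ->
    chart_dom c (s t) /\ chart_img c (y t)) -> C1_segment S s'.
Proof.
move=> near_ball; apply: C1_segment_of_near => t t01.
have nC := C1_segment_near Cs t01; have Ct := nbhs_singleton nC.
have n1 : \forall u \near t, (-1 : R) < u by apply: lt_nbhsr; lra.
have t1 : (-1 : R) < t := nbhs_singleton n1.
have [rl|lr] := ltP rho (ell t).
  have ns := near_join (perturbed_near_far t1 rl).
  near=> u; apply: (@near_eq_C1_curve_at _ _ _ _ s).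
    have : {near u, s' =1 s} by near: u.
    by apply: filterS => v; exact: esym.
  by near: u.
have [dt it] := near_ball t t01 lr.
have [Cy _] := perturbed_coords_C1 t1 Ct dt.
have nd := near_chart_dom Ct.1 dt.
have ni : \forall u \near t, chart_img c (y u).
  by apply: (C1_at_continuous Cy); apply: open_nbhs_nbhs; split => //; exact: chart_img_open.
near=> u; have Cu : C1_curve_at S s u by near: u.
have du : chart_dom c (s u) by near: u.
have iu : chart_img c (y u) by near: u.
have u1 : (-1 : R) < u by near: u.
apply: (@near_eq_C1_curve_at _ _ _ _ (chart_inv c \o y)).
  by apply: filterS (perturbed_near_coords Cu du) => v; exact: esym.
exact: C1_curve_of_coords (perturbed_coords_C1 u1 Cu du).1.
Unshelve. all: by end_near. Qed.

Lemma perturbed_speed_near t : 0 <= t <= 1 -> chart_dom c (s t) ->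
  chart_img c (y t) ->
  let v := derive1 (chart_map c \o s) t +
    (derive1 (cutoff rho) (ell t) * derive1 ell t) *: h in
  speed g s' t = Num.sqrt (bilin (gram g c (y t)) v v).
Proof.
move=> t01 dt it v; have t1 : (-1 : R) < t by lra.
have Ct := C1_segment_at Cs t01.
have [Cy Ey] := perturbed_coords_C1 t1 Ct dt.
by rewrite (speed_of_coords ac Cy it (perturbed_near_coords Ct dt)) Ey.
Qed.

Lemma perturbed_speed_far t : 0 <= t <= 1 -> rho < ell t ->
  speed g s' t = speed g s t.
Proof.
move=> t01 rl; have t1 : (-1 : R) < t by lra.
exact: near_eq_speed (C1_segment_at Cs t01) (perturbed_near_far t1 rl).
Qed.

End Curve.
End Fixed.
End Perturbation.

(** * Semiconcavity of the squared distance *)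

Section SemiConcavity.
Context (R : realType) (n : nat) (M : ptopologicalType).
Context (S : smooth_structure R n M) (g : riemannian_metric S).
Context (hausdorffM : hausdorff_space M).
Local Notation lebesgue := (@lebesgue_measure R).

Lemma length_affine (s : R -> M) (A B : R) : C1_segment S s ->
  lebesgue.-integrable `[0, 1] (EFin \o (fun t => A * speed g s t + B)) /\
  \int[lebesgue]_(t in `[0, 1]) (A * speed g s t + B) =
    A * curve_length g s + B.
Proof.
move=> Cs; rewrite curve_length.unlock; have iS := speed_integrable g Cs.
have cS t : 0 <= t <= 1 -> {for t, continuous (speed g s)}.
  by move=> t01; exact: speed_continuous (C1_segment_at Cs t01).
have cA t : 0 <= t <= 1 -> {for t, continuous (fun t => A * speed g s t)}.
  move=> t01; have cc : {for t, continuous (cst A : R -> R)} by exact: cst_continuous.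
  exact: (cvgM cc (cS t t01)).
have cB t : {for t, continuous (cst B : R -> R)} by exact: cst_continuous.
have iA := continuous_unit_integrable cA.
split.
  by apply: continuous_unit_integrable => t t01; exact: (cvgD (cA t t01) (cB t)).
rewrite (RintegralD (@measurable_unit R) iA (cst_integrable B)).
by rewrite (RintegralZl _ (@measurable_unit R) iS) Rintegral_unit_cst.
Qed.

Lemma length_pair_le (s s1 s2 : R -> M) (A B : R) :
  C1_segment S s -> C1_segment S s1 -> C1_segment S s2 ->
  (forall t, 0 <= t <= 1 -> speed g s1 t + speed g s2 t <= A * speed g s t + B) ->
  curve_length g s1 + curve_length g s2 <= A * curve_length g s + B.
Proof.
move=> Cs C1 C2 le.
have i1 := speed_integrable g C1; have i2 := speed_integrable g C2.
have [iA <-] := length_affine A B Cs; rewrite curve_length.unlock.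
rewrite -(RintegralD (@measurable_unit R) i1 i2).
apply: (le_Rintegral (@measurable_unit R) _ iA).
  apply: continuous_unit_integrable => t t01.
  exact: (cvgD (speed_continuous (C1_segment_at C1 t01)) (speed_continuous (C1_segment_at C2 t01))).
by move=> t; rewrite /= in_itv /=; exact: le.
Qed.

Section Fixed.
Variables (c : chart R n M) (x0 : 'rV[R]_n) (r K : R).
Hypotheses (ac : atlas S c) (G : good_ball g c x0 r K).
Variables (rho : R) (h : 'rV[R]_n).
Hypotheses (rho0 : 0 < rho) (rho1 : rho <= 1) (Krho : 2 * K * rho < r).
Hypothesis hr : `|h| <= r / 2.

Let C : R := 9 * K ^+ 3 * (`|h| / rho) ^+ 2.

(** The invariant along a path: a point reached after arc length [l <= rho] has
    moved by at most [K * l] in the chart. *)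
Definition controlled (l : R) (p : M) : Prop :=
  l <= rho -> in_ball c x0 (K * l) p.

(** The parameter [l] of the perturbation is the arc length increased by [eta]
    times the time: its derivative is then positive, as the division by it in the
    estimate of the speeds requires, even where the curve stops. *)
Lemma perturb_piece (s : R -> M) (l0 eta : R) : C1_segment S s ->
  0 <= l0 -> 0 < eta -> controlled l0 (s 0) ->
  let L := curve_length g s in
  let l1 := l0 + (L + eta) in
  controlled l1 (s 1) /\ exists sp sm,
  [/\ C1_segment S sp /\ C1_segment S sm,
      sp 0 = perturb c rho h l0 (s 0) /\ sp 1 = perturb c rho h l1 (s 1),
      sm 0 = perturb c rho (- h) l0 (s 0) /\ sm 1 = perturb c rho (- h) l1 (s 1) &
      curve_length g sp + curve_length g sm <= (2 + C) * L + (1 + C) * eta].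
Proof.
move=> Cs l0_ge0 eta0 ctl L l1.
have K1 := good_const G; have r0 := good_radius G.
have cS (t : R) : 0 <= t <= 1 -> {for t, continuous (fun t => 1 * speed g s t + eta)}.
  move=> t01; have c1 : {for t, continuous (cst 1 : R -> R)} by exact: cst_continuous.
  have ce : {for t, continuous (cst eta : R -> R)} by exact: cst_continuous.
  exact: (cvgD (cvgM c1 (speed_continuous (C1_segment_at Cs t01))) ce).
have [ell [e0 e1 Cell dell]] := primitive01 l0 cS.
rewrite (length_affine 1 eta Cs).2 mul1r -/L -/l1 in e1.
have sle (u : R) : 0 <= u <= 1 -> derivable ell u 1 /\ speed g s u <= derive1 ell u.
  move=> u01; split; first by apply: C1_at_derivable; apply: Cell; lra.
  by rewrite dell // mul1r lerDl ltW.
have sC (u : R) : 0 <= u <= 1 -> C1_curve_at S s u by exact: C1_segment_at.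
have Kr : K * rho < r by move: Krho; nra.
have mono := arc_nondecreasing sle.
have ctl0 : ell 0 <= rho -> in_ball c x0 (K * ell 0) (s 0) by rewrite e0; exact: ctl.
have inb := containment hausdorffM ac G Kr sC sle ctl0.
split; first by rewrite -e1; apply: inb; lra.
have half (t : R) : 0 <= t <= 1 -> ell t <= rho ->
    chart_dom c (s t) /\ `|chart_map c (s t) - x0| <= r / 2.
  move=> t01 tr; have [d b] := inb t t01 tr; split => //.
  apply: le_trans b _; have : K * ell t <= K * rho by rewrite ler_wpM2l //; lra.
  move: Krho; lra.
have ell_ge0 (t : R) : 0 <= t <= 1 -> 0 <= ell t.
  by move=> t01; apply: (le_trans l0_ge0); rewrite -e0; apply: mono; lra.
have cut (t : R) (k : 'rV[R]_n) : 0 <= t <= 1 -> `|cutoff rho (ell t) *: k| <= `|k|.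
  move=> t01; have /andP[c0 c1] := cutoff_itv rho0 (ell_ge0 t t01).
  by rewrite mx_normZ ger0_norm // ler_piMl.
have shifted (t : R) (k : 'rV[R]_n) : 0 <= t <= 1 -> ell t <= rho -> `|k| <= r / 2 ->
    `|chart_map c (s t) + cutoff rho (ell t) *: k - x0| <= r.
  move=> t01 tr kr; have [_ b] := half t t01 tr.
  rewrite addrAC; apply: le_trans (ler_normD _ _) _.
  by have := cut t k t01; lra.
have nhr : `|- h| <= r / 2 by rewrite normrN.
pose sp (t : R) := perturb c rho h (ell t) (s t).
pose sm (t : R) := perturb c rho (- h) (ell t) (s t).
have nearP k : `|k| <= r / 2 -> forall t : R, 0 <= t <= 1 -> ell t <= rho ->
    chart_dom c (s t) /\ chart_img c (chart_map c (s t) + cutoff rho (ell t) *: k).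
  move=> kr t t01 tr; split; first by have [] := half t t01 tr.
  by apply: (good_img G); exact: shifted.
have Csp : C1_segment S sp by exact: (perturbed_C1_segment ac rho0 Cs Cell (nearP h hr)).
have Csm : C1_segment S sm by exact: (perturbed_C1_segment ac rho0 Cs Cell (nearP _ nhr)).
have a0 : 0 <= `|h| / rho by rewrite divr_ge0 // ltW.
have K3 : 0 <= K ^+ 3 by apply: exprn_ge0; lra.
have C0 : 0 <= C by rewrite /C mulr_ge0 ?sqr_ge0 //; lra.
exists sp, sm; split; [by []|by rewrite /sp e0 e1|by rewrite /sm e0 e1|].
apply: length_pair_le => // t t01.
have sp0 := speed_ge0 g s t.
have [lr|tr] := ltP rho (ell t).
  rewrite (perturbed_speed_far g c h Cs Cell t01 lr).
  rewrite (perturbed_speed_far g c (- h) Cs Cell t01 lr).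
  have := mulr_ge0 C0 sp0; have := mulr_ge0 C0 (ltW eta0); lra.
have [dt it] := nearP h hr t t01 tr.
have [_ imt] := nearP _ nhr t t01 tr.
rewrite (perturbed_speed_near g ac rho0 Cs Cell t01 dt it).
rewrite (perturbed_speed_near g ac rho0 Cs Cell t01 dt imt).
have Ct := C1_segment_at Cs t01.
have sE := speed_chart g ac dt Ct.1 (C1_at_derivable (Ct.2 c ac dt)).
have [_ xb] := half t t01 tr.
have xr : `|chart_map c (s t) - x0| <= r by lra.
have xp := shifted t h t01 tr hr.
have xm := shifted t _ t01 tr nhr.
rewrite !scalerN in xm *.
have ws : speed g s t <= speed g s t + eta by rewrite lerDl ltW.
have s0 : 0 < speed g s t + eta by lra.
have ka : `|cutoff rho (ell t) *: h| <= `|h| / rho.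
  apply: le_trans (cut t h t01) _.
  by rewrite (ler_pdivlMr _ _ rho0); exact: (ler_piMr (normr_ge0 h) rho1).
have ma : `|(derive1 (cutoff rho) (ell t) * derive1 ell t) *: h| <=
    2 * (`|h| / rho) * (speed g s t + eta).
  rewrite mx_normZ normrM (dell t t01) mul1r (ger0_norm (ltW s0)).
  have -> : 2 * (`|h| / rho) * (speed g s t + eta) = 2 / rho * (speed g s t + eta) * `|h| by ring.
  apply: (ler_wpM2r (normr_ge0 h)); apply: (ler_wpM2r (ltW s0)).
  exact: (cutoff_derive_le rho0 (ell_ge0 t t01)).
have := speed_pair_bound ac G xr xp xm sE ws s0 a0 ka ma.
rewrite -/C; lra.
Qed.

(** The accumulated arc length at the end of one piece is the initial one of the
    next, so the perturbed pieces fit together. *)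
Lemma perturb_path l (p q : M) (l0 eta : R) : piecewise_C1_path S p l q ->
  0 <= l0 -> 0 < eta -> controlled l0 p ->
  let l1 := l0 + (path_length g l + (size l)%:R * eta) in
  exists lp lm,
  [/\ piecewise_C1_path S (perturb c rho h l0 p) lp (perturb c rho h l1 q),
      piecewise_C1_path S (perturb c rho (- h) l0 p) lm (perturb c rho (- h) l1 q) &
      path_length g lp + path_length g lm <=
        (2 + C) * path_length g l + (1 + C) * ((size l)%:R * eta)].
Proof.
elim: l p l0 => [|s l IH] p l0 /=.
  move=> -> l0_ge0 eta0 _; exists [::], [::].
  by rewrite path_length_nil !mul0r !addr0 !mulr0 /=; split.
move=> [Cs s0 sl] l0_ge0 eta0 ctl.
rewrite -s0 in ctl.
have [ctl1 [sp [sm [[Csp Csm] [sp0 sp1] [sm0 sm1] le]]]] := perturb_piece Cs l0_ge0 eta0 ctl.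
have L0 := curve_length_ge0 g s.
have l1_ge0 : 0 <= l0 + (curve_length g s + eta) by rewrite !addr_ge0 // ltW.
have [lp [lm [plp plm le']]] := IH _ _ sl l1_ge0 eta0 ctl1.
have e : l0 + (path_length g (s :: l) + (size l).+1%:R * eta) =
    l0 + (curve_length g s + eta) + (path_length g l + (size l)%:R * eta).
  by rewrite path_length_cons -addn1 natrD; ring.
exists (sp :: lp), (sm :: lm); rewrite e; split.
- by split => //; [rewrite sp0 s0|rewrite sp1].
- by split => //; [rewrite sm0 s0|rewrite sm1].
- by rewrite !path_length_cons -addn1 natrD; lra.
Qed.

(** A nearly shortest path from the centre to [q] is at least [rho] long, so that its
    two perturbations end at [q], while they start at the points with coordinates
    [x0 + h] and [x0 - h]. *)
Lemma dist_second_difference (conn : forall p q, joined S p q) (q : M) :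
  let p := chart_inv c x0 in rho <= dist g p q ->
  dist g (chart_inv c (x0 + h)) q + dist g (chart_inv c (x0 - h)) q <=
  (2 + C) * dist g p q.
Proof.
move=> p rd; apply/ler_addgt0Pr => e e0.
have r0 := good_radius G; have K1 := good_const G.
have K3 : 0 <= K ^+ 3 by apply: exprn_ge0; lra.
have C0 : 0 <= C by rewrite /C mulr_ge0 ?sqr_ge0 //; lra.
have D0 : 0 < 3 + 2 * C by lra.
have e'0 : 0 < e / (3 + 2 * C) by rewrite divr_gt0.
set e' := e / (3 + 2 * C) in e'0.
have [l pl ll] := near_minimal_path g (conn p q) e'0.
have sz0 : 0 < (size l)%:R + 1 :> R by rewrite ltr_wpDl.
(* Each piece of the path costs [eta], so all together they cost at most [e']. *)
pose eta := e' / ((size l)%:R + 1).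
have eta0 : 0 < eta by rewrite divr_gt0.
have seta : (size l)%:R * eta <= e'.
  by rewrite /eta mulrCA ger_pMr // ler_pdivrMr // mul1r lerDl.
have ix0 : chart_img c x0.
  by apply: (good_img G); rewrite subrr normr0 ltW.
have ctl : controlled 0 p.
  move=> _; split; first exact: chart_invP.
  by rewrite /p chart_invK // subrr normr0 mulr0.
have [lp [lm [plp plm le]]] := perturb_path pl (lexx 0) eta0 ctl.
have end_ k : perturb c rho k (0 + (path_length g l + (size l)%:R * eta)) q = q.
  rewrite /perturb add0r ltNge (le_trans rd) //.
  have := dist_le_length g pl; have : 0 <= (size l)%:R * eta by rewrite mulr_ge0 // ltW.
  lra.
have start_ k : perturb c rho k 0 p = chart_inv c (x0 + k).
  by rewrite /perturb rho0 cutoff0 scale1r /p chart_invK.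
rewrite end_ start_ in plp; rewrite end_ start_ in plm.
have dp := dist_le_length g plp; have dm := dist_le_length g plm.
have ee : e = (3 + 2 * C) * e' by rewrite /e' mulrC divfK // gt_eqF.
have S1 : (1 + C) * ((size l)%:R * eta) <= (1 + C) * e' by rewrite ler_wpM2l //; lra.
have S2 : (2 + C) * path_length g l <= (2 + C) * (dist g p q + e').
  by rewrite ler_wpM2l //; lra.
by rewrite ee; lra.
Qed.

End Fixed.

Lemma sum_sq_le (a b1 b2 D E : R) : `|b1 - a| <= D -> `|b2 - a| <= D ->
  2 * a * (b1 + b2 - 2 * a) <= E ->
  b1 ^+ 2 + b2 ^+ 2 <= 2 * a ^+ 2 + 2 * D ^+ 2 + E.
Proof.
move=> d1 d2 le; have D0 : 0 <= D := le_trans (normr_ge0 _) d1.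
have sq (b : R) : `|b - a| <= D -> (b - a) ^+ 2 <= D ^+ 2.
  by move=> bD; rewrite -[leLHS]real_normK ?num_real // ler_pXn2r ?nnegrE.
have := sq b1 d1; have := sq b2 d2; lra.
Qed.

(** The perturbation length is the distance [a] itself when [a] is small, and a fixed
    length otherwise.  In the first case the second difference of the distance is
    of order [`|h| ^+ 2 / a], which the factor [2 * a] of the square absorbs; in
    the second it grows like [a], so the constant for the squared distance grows
    like [a ^+ 2], which is integrable. *)
Lemma dist_sq_second_difference (c : chart R n M) (x0 : 'rV[R]_n)
    (conn : forall p q, joined S p q) : atlas S c -> chart_img c x0 ->
  exists C delta : R, [/\ 0 < delta, 0 <= C &
  forall h q, `|h| <= delta ->
  dist g (chart_inv c (x0 + h)) q ^+ 2 + dist g (chart_inv c (x0 - h)) q ^+ 2 <=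
  2 * dist g (chart_inv c x0) q ^+ 2 +
    C * `|h| ^+ 2 * (1 + dist g (chart_inv c x0) q ^+ 2)].
Proof.
move=> ac ix0; have [r [K G]] := near_good_ball g ac ix0.
have r0 := good_radius G; have K1 := good_const G.
have K0 : 0 < K by lra.
pose t0 := Num.min 1 (r / (4 * K)).
have t0_gt0 : 0 < t0 by rewrite lt_min ltr01 divr_gt0 //; lra.
have t0_le1 : t0 <= 1 by rewrite ge_min lexx.
have t0_le : 2 * K * t0 < r.
  have : t0 <= r / (4 * K) by rewrite ge_min lexx orbT.
  rewrite ler_pdivlMr; lra.
have K3 : 0 <= K ^+ 3 by apply: exprn_ge0; lra.
have i0 : 0 <= t0^-1 ^+ 2 by rewrite sqr_ge0.
exists (2 * K ^+ 2 + 18 * K ^+ 3 * (1 + t0^-1 ^+ 2)), (r / 2); split.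
- by rewrite divr_gt0.
- by rewrite addr_ge0 ?mulr_ge0 ?sqr_ge0 //; lra.
move=> h q hr; set p := chart_inv c x0; set a := dist g p q.
set b1 := dist g _ q; set b2 := dist g _ q.
have a0 : 0 <= a by exact: dist_ge0.
have b10 : 0 <= b1 by exact: dist_ge0.
have b20 : 0 <= b2 by exact: dist_ge0.
have xx : `|x0 - x0| <= r by rewrite subrr normr0 ltW.
have close (k : 'rV[R]_n) : `|k| <= r / 2 ->
    `|dist g (chart_inv c (x0 + k)) q - a| <= K * `|k|.
  move=> kr; have xk : `|x0 + k - x0| <= r by rewrite addrAC subrr add0r; lra.
  have [_ d1] := chart_joined ac G xx xk; have [_ d2] := chart_joined ac G xk xx.
  rewrite addrAC subrr add0r in d1; rewrite opprD addrA subrr sub0r normrN in d2.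
  have := dist_triangle g (conn p (chart_inv c (x0 + k))) (conn (chart_inv c (x0 + k)) q).
  have := dist_triangle g (conn (chart_inv c (x0 + k)) p) (conn p q).
  by rewrite ler_norml -/a; lra.
have cl1 := close h hr; rewrite -/b1 in cl1.
have cl2 := close (- h); rewrite normrN -/b2 in cl2; have {}cl2 := cl2 hr.
have h0 : 0 <= `|h| by [].
have h2 : 0 <= `|h| ^+ 2 by exact: exprn_ge0.
have a2 : 0 <= a ^+ 2 by exact: sqr_ge0.
have KhA := mulr_ge0 (mulr_ge0 (sqr_ge0 K) h2) a2.
suff main : 2 * a * (b1 + b2 - 2 * a) <=
    18 * K ^+ 3 * `|h| ^+ 2 * ((1 + t0^-1 ^+ 2) * (1 + a ^+ 2)).
  apply: le_trans (sum_sq_le cl1 cl2 main) _.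
  by rewrite exprMn; move: KhA; clear; lra.
have E0 : 0 <= 18 * K ^+ 3 * `|h| ^+ 2.
  by apply: mulr_ge0 h2; exact: mulr_ge0.
have [a_le0|a_gt0] := leP a 0.
  have -> : a = 0 by lra.
  by rewrite mulr0 mul0r expr0n /= addr0 mulr1 mulr_ge0 // addr_ge0.
pose rho := Num.min t0 a.
have rho0 : 0 < rho by rewrite lt_min t0_gt0.
have rho_t0 : rho <= t0 by rewrite ge_min lexx.
have rho_a : rho <= a by rewrite ge_min lexx orbT.
have rho1 : rho <= 1 by lra.
have Krho : 2 * K * rho < r.
  by apply: le_lt_trans t0_le; rewrite ler_wpM2l //; lra.
have D := dist_second_difference ac G rho0 rho1 Krho hr conn rho_a.
rewrite -/p -/a -/b1 -/b2 in D.
have E1 : 2 * a * (b1 + b2 - 2 * a) <= 18 * K ^+ 3 * `|h| ^+ 2 * (a / rho) ^+ 2.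
  have -> : 18 * K ^+ 3 * `|h| ^+ 2 * (a / rho) ^+ 2 =
    2 * a * ((9 * K ^+ 3 * (`|h| / rho) ^+ 2) * a) by ring.
  by rewrite ler_wpM2l //; lra.
apply: le_trans E1 _; apply: ler_wpM2l => //.
have E2 : (a / rho) ^+ 2 <= 1 + t0^-1 ^+ 2 * a ^+ 2.
  rewrite /rho; case: (leP t0 a) => ta.
    by rewrite exprMn mulrC; lra.
  by rewrite divff ?gt_eqF // expr1n lerDl mulr_ge0.
by apply: le_trans E2 _; move: i0 a2; clear; lra.
Qed.

End SemiConcavity.

(** * Geodesics have constant speed *)

Section GeodesicSpeed.
Context (R : realType) (n : nat).

Lemma is_derive_bilin (G : R -> 'M[R]_n) (u v : R -> 'rV[R]_n) (t : R)
    (dG : 'M[R]_n) (du dv : 'rV[R]_n) :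
  is_derive t 1 G dG -> is_derive t 1 u du -> is_derive t 1 v dv ->
  is_derive t 1 (fun s => bilin (G s) (u s) (v s))
    (bilin dG (u t) (v t) + bilin (G t) du (v t) + bilin (G t) (u t) dv).
Proof.
move=> DG Du Dv.
pose term (j i : 'I_n) (s : R) : R := u s 0 i * G s i j * v s 0 j.
pose dterm (j i : 'I_n) : R := u t 0 i * dG i j * v t 0 j +
  du 0 i * G t i j * v t 0 j + u t 0 i * G t i j * dv 0 j.
have Dt j i : is_derive t 1 (term j i) (dterm j i).
  have D1 : is_derive t 1 (fun s => u s 0 i * G s i j : R)
      (u t 0 i * dG i j + G t i j * du 0 i).
    exact: (is_deriveM (is_derive_coord 0 i Du) (is_derive_coord i j DG)).
  have D2 : is_derive t 1 (term j i) (u t 0 i * G t i j * dv 0 j +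
      v t 0 j * (u t 0 i * dG i j + G t i j * du 0 i)).
    exact: (is_deriveM D1 (is_derive_coord 0 j Dv)).
  by apply: is_derive_eq D2 _; rewrite /dterm; ring.
have DS := is_derive_sum (fun j => is_derive_sum (Dt j)).
have -> : (fun s => bilin (G s) (u s) (v s)) = \sum_(j < n) \sum_(i < n) term j i.
  apply/funext => s; rewrite bilinE fct_sumE; apply: eq_bigr => j _.
  by rewrite fct_sumE.
apply: is_derive_eq DS _; rewrite !bilinE -!big_split /=.
apply: eq_bigr => j _; rewrite -!big_split /=.
by apply: eq_bigr => i _; rewrite /dterm.
Qed.

Lemma posdef_unitmx (G : 'M[R]_n) :
  (forall v : 'rV[R]_n, v != 0 -> 0 < bilin G v v) -> G \in unitmx.
Proof.
move=> Gpos; rewrite -row_free_unit -kermx_eq0; apply/rowV0P => v /sub_kermxP vG.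
apply/eqP/contraT => /Gpos; by rewrite /bilin vG mul0mx mxE ltxx.
Qed.

(** The Levi-Civita identity: lowering the index of the geodesic acceleration
    with the metric cancels its inverse, and renaming the summation indices
    collapses the three derivatives of the metric to one. *)
Lemma christoffel_contraction (G : 'M[R]_n) (D : 'I_n -> 'M[R]_n)
    (v acc : 'rV[R]_n) : G \in unitmx ->
  (forall k : 'I_n, acc 0 k = - \sum_(a < n) \sum_(b < n)
     (2^-1 * \sum_(l < n) invmx G k l * (D a l b + D b l a - D l a b)) *
       v 0 a * v 0 b) ->
  bilin G v acc = - (2^-1 * bilin (\sum_(a < n) v 0 a *: D a) v v).
Proof.
move=> Gu accE.
pose w (l : 'I_n) := \sum_(a < n) \sum_(b < n) (D a l b + D b l a - D l a b) * v 0 a * v 0 b.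
have accT : acc^T = - 2^-1 *: (invmx G *m \col_l w l).
  apply/colP => k; rewrite !mxE accE mulNr mulr_sumr; congr (- _).
  under eq_bigr do (under eq_bigr do rewrite mulr_sumr !mulr_suml).
  under eq_bigr do rewrite exchange_big.
  rewrite exchange_big; apply: eq_bigr => l _.
  rewrite mxE /w !mulr_sumr; apply: eq_bigr => a _.
  by rewrite !mulr_sumr; apply: eq_bigr => b _; ring.
rewrite {1}/bilin accT -scalemxAr mulmxA -(mulmxA v) mulmxV // mulmx1 mxE -mulNr; congr (_ * _).
rewrite -/(bilin _ v v) bilinE mxE.
pose T := \sum_(l < n) \sum_(a < n) \sum_(b < n) D a l b * v 0 l * v 0 a * v 0 b.
have T1 : T = \sum_(l < n) \sum_(a < n) \sum_(b < n) D b l a * v 0 l * v 0 a * v 0 b.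
  apply: eq_bigr => l _; rewrite exchange_big; apply: eq_bigr => a _.
  by apply: eq_bigr => b _; ring.
have T2 : T = \sum_(l < n) \sum_(a < n) \sum_(b < n) D l a b * v 0 l * v 0 a * v 0 b.
  rewrite /T exchange_big; apply: eq_bigr => l _; apply: eq_bigr => a _.
  by apply: eq_bigr => b _; ring.
transitivity T.
  have -> : T = T + T - T by ring.
  rewrite [X in _ + X - _]T1 [X in _ - X]T2 /T -!big_split -sumrB /=; apply: eq_bigr => l _.
  rewrite mxE /w mulr_sumr -!big_split -sumrB /=; apply: eq_bigr => a _.
  rewrite mulr_sumr -!big_split -sumrB /=; apply: eq_bigr => b _.
  by ring.
rewrite /T; under eq_bigr do rewrite exchange_big.
rewrite exchange_big; apply: eq_bigr => b _; apply: eq_bigr => l _.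
rewrite summxE mulr_sumr mulr_suml; apply: eq_bigr => a _.
by rewrite mxE; ring.
Qed.

Lemma sq_inj (a b : R) : 0 <= a -> 0 <= b -> a ^+ 2 = b ^+ 2 -> a = b.
Proof. by move=> a0 b0 /eqP; rewrite eqrXn2 // => /eqP. Qed.

Context (M : ptopologicalType).
Context (S : smooth_structure R n M) (g : riemannian_metric S).

Lemma geodesic_C1 (s : R -> M) (t : R) : geodesic g s -> C1_curve_at S s t.
Proof.
move=> gs; have [cs Cs] := gs t; split => // c ac dct.
have [dx ddx _] := Cs c ac dct; split; last exact: derivable1_continuous.
apply: filterS (near_chart_dom cs dct) => u du.
by have [_ /(_ c ac du)[]] := gs u.
Qed.

Lemma geodesic_speed (s : R -> M) (t : R) : geodesic g s ->
  speed g s t = speed g s 0.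
Proof.
move=> gs.
apply: (sq_inj (speed_ge0 g s t) (speed_ge0 g s 0)).
apply: (@is_derive_0_is_cst R (fun u => speed g s u ^+ 2)) => {}t.
have [cs Cs] := gs t; pose c := chart_at S (s t).
have ac : atlas S c by exact: chart_at_atlas.
have dct : chart_dom c (s t) by exact: chart_at_dom.
have [dx ddx geo] := Cs c ac dct.
pose x := chart_map c \o s; pose v := derive1 x.
have nE : \forall u \near t, bilin (gram g c (x u)) (v u) (v u) = speed g s u ^+ 2.
  apply: filterS (near_chart_dom cs dct) => u du.
  have [csu Csu] := gs u; have [dxu _ _] := Csu c ac du.
  rewrite (speed_chart g ac du csu dxu) sqr_sqrtr //.
  by apply: bilin_gram_ge0 => //; exact: chart_mapP.
apply: near_eq_is_derive nE _.
have ix : chart_img c (x t) by exact: chart_mapP.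
have dg : differentiable (gram g c) (x t).
  have [d _] : Ck_on 1 (chart_img c) (gram g c) by exact: (gram_smooth g ac 1%N).
  exact: d.
have [dgx egx] := derive1_chain dx dg.
have Dg := is_derive_derive1 dgx; rewrite egx (diff_coords _ dg) in Dg.
have Dv := is_derive_derive1 ddx.
apply: is_derive_eq (is_derive_bilin Dg Dv Dv) _.
have Gpos := fun w => @gram_pos _ _ _ _ g c (x t) w ac ix.
have Gu := posdef_unitmx Gpos.
have C := christoffel_contraction Gu geo.
have cancel (z y : R) : y = - (2^-1 * z) -> z + y + y = 0 by move=> ->; field.
by rewrite (bilin_sym _ _ (gram_sym g ac ix)); exact: (cancel _ _ C).
Qed.

End GeodesicSpeed.

(** * The Frechet function near a local minimum *)

Lemma sq_le_of_le_add (R : realType) (a b d : R) : 0 <= a -> 0 <= b -> 0 <= d ->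
  a <= b + d -> a ^+ 2 <= 2 * b ^+ 2 + 2 * d ^+ 2.
Proof.
move=> a0 b0 d0 le.
have : a ^+ 2 <= (b + d) ^+ 2 by rewrite ler_pXn2r // nnegrE addr_ge0.
have := sqr_ge0 (b - d); rewrite !expr2; lra.
Qed.

Lemma differentiable_of_quadratic (R : realType) (V W : normedModType R)
    (f : V -> W) (x0 : V) (C delta : R) :
  0 < delta -> 0 <= C ->
  (forall y, `|y - x0| <= delta -> `|f y - f x0| <= C * `|y - x0| ^+ 2) ->
  differentiable f x0.
Proof.
move=> d0 C0 fC.
have cz : continuous (\0 : V -> W) by exact: cst_continuous.
have dxf : f \o shift x0 = cst (f x0) + \0 +o_ 0 id.
  apply/eqaddoP => e e0.
  have m0 : 0 < Num.min delta (e / (C + 1)).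
    by rewrite lt_min d0 divr_gt0 //; lra.
  have nm : \forall k \near (0 : V), `|k| <= Num.min delta (e / (C + 1)).
    have /cvgrPdist_le /(_ _ m0) : {for (0 : V), continuous (fun k : V => k)} by exact: id.
    by apply: filterS => k; rewrite /= sub0r normrN.
  apply: filterS nm => k; rewrite le_min => /andP[k1 k2].
  have := fC (k + x0); rewrite addrK => /(_ k1) le1.
  have -> : (f \o shift x0 - (cst (f x0) + \0)) k = f (k + x0) - f x0.
    by rewrite !fctE /= addr0.
  apply: le_trans le1 _; rewrite expr2 mulrA ler_wpM2r //.
  move: k2; rewrite ler_pdivlMr; [|lra].
  by have := normr_ge0 k; lra.
have E := diff_unique cz dxf.
by apply/diff_locallyP; rewrite E.
Qed.

Section Frechet.
Context (R : realType) (n : nat) (M : ptopologicalType).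
Context (S : smooth_structure R n M) (g : riemannian_metric S).
Context (hausdorffM : hausdorff_space M).
Context (conn : forall p q, joined S p q).
Context (Q : probability (g_sigma_algebraType (@open M)) R).

Lemma measurable_dist (p : M) :
  measurable_fun [set: g_sigma_algebraType (@open M)]
    (dist g p : g_sigma_algebraType (@open M) -> R).
Proof.
apply: (measurability _ (RGenOInfty.measurableE R)) => _ [_ [a ->] <-].
rewrite setTI; apply: sub_sigma_algebra.
apply: open_comp; last exact: interval_open.
by move=> x _; exact: dist_continuous.
Qed.

Lemma measurable_dist_sq (p : M) :
  measurable_fun [set: g_sigma_algebraType (@open M)]
    ((fun x => dist g p x ^+ 2) : g_sigma_algebraType (@open M) -> R).
Proof. by apply: measurable_funX; exact: measurable_dist. Qed.

Context (q0 : M).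
Hypothesis moment : (\int[Q]_x (dist g q0 x ^+ 2)%:E < +oo)%E.

(** From one base point to all of them, by the triangle inequality. *)
Lemma dist_sq_integrable (p : M) :
  Q.-integrable setT (EFin \o (fun x => dist g p x ^+ 2)).
Proof.
have mE q : measurable_fun [set: g_sigma_algebraType (@open M)]
    (EFin \o ((fun x => dist g q x ^+ 2) : g_sigma_algebraType (@open M) -> R)).
  by apply/measurable_EFinP; exact: measurable_dist_sq.
have i0 : Q.-integrable setT (EFin \o (fun x => dist g q0 x ^+ 2)).
  apply/integrableP; split; first exact: mE.
  apply: le_lt_trans moment; apply: ge0_le_integral => //.
  - by apply: measurableT_comp => //; exact: mE.
  - exact: mE.
  - by move=> x _ /=; rewrite lee_fin ger0_norm // sqr_ge0.
have ic : Q.-integrable setT (EFin \o (fun=> 2 * dist g p q0 ^+ 2)).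
  exact: finite_measure_integrable_cst.
have i2 : Q.-integrable setT (EFin \o (fun x => 2 * dist g q0 x ^+ 2)).
  by apply: eq_integrable (integrableZl measurableT 2 i0).
apply: (le_integrable measurableT _ _ (integrableD measurableT ic i2)).
  exact: mE.
move=> x _ /=; rewrite lee_fin.
have h0 q x' : 0 <= 2 * dist g q x' ^+ 2 by rewrite pmulr_rge0 // sqr_ge0.
rewrite (ger0_norm (sqr_ge0 _)) (ger0_norm (addr_ge0 (h0 _ _) (h0 _ _))).
apply: (sq_le_of_le_add (dist_ge0 _ _ _) (dist_ge0 _ _ _) (dist_ge0 _ _ _)).
exact: (dist_triangle g (conn p q0) (conn q0 x)).
Qed.

Lemma frechet_second_difference (c : chart R n M) (x0 : 'rV[R]_n) :
  atlas S c -> chart_img c x0 -> exists C delta : R, [/\ 0 < delta, 0 <= C &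
  forall h, `|h| <= delta ->
    frechet g Q (chart_inv c (x0 + h)) + frechet g Q (chart_inv c (x0 - h)) <=
    2 * frechet g Q (chart_inv c x0) + C * `|h| ^+ 2].
Proof.
move=> ac ix0; have [C [delta [d0 C0 CP]]] := dist_sq_second_difference g hausdorffM conn ac ix0.
have F0 p : 0 <= frechet g Q p by apply: Rintegral_ge0 => x _; exact: sqr_ge0.
exists (C * (1 + frechet g Q (chart_inv c x0))), delta; split => //.
  by rewrite mulr_ge0 // addr_ge0.
move=> h hd; set p := chart_inv c x0.
have A0 : 0 <= C * `|h| ^+ 2 by rewrite mulr_ge0 // exprn_ge0.
set A := C * `|h| ^+ 2 in A0 *.
have ic : Q.-integrable setT (EFin \o (fun=> A)) by exact: finite_measure_integrable_cst.
have ip := dist_sq_integrable p.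
have i2 : Q.-integrable setT (EFin \o (fun x => (2 + A) * dist g p x ^+ 2)).
  by apply: eq_integrable (integrableZl measurableT (2 + A) ip).
have is_ : Q.-integrable setT (EFin \o (fun x => A + (2 + A) * dist g p x ^+ 2)).
  by apply: eq_integrable (integrableD measurableT ic i2).
have i_p := dist_sq_integrable (chart_inv c (x0 + h)).
have i_m := dist_sq_integrable (chart_inv c (x0 - h)).
have il : Q.-integrable setT (EFin \o (fun x => dist g (chart_inv c (x0 + h)) x ^+ 2 + dist g (chart_inv c (x0 - h)) x ^+ 2)).
  by apply: eq_integrable (integrableD measurableT i_p i_m).
have -> : 2 * frechet g Q p + C * (1 + frechet g Q p) * `|h| ^+ 2 =
    A + (2 + A) * frechet g Q p by rewrite /A; ring.
rewrite /frechet -(RintegralD measurableT i_p i_m).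
rewrite -(RintegralZl (2 + A) measurableT ip).
have eA : A = \int[Q]_x A.
  rewrite [RHS](Rintegral_cst Q measurableT) [X in fine X](_ : _ = 1%E) ?mulr1 //.
  exact: probability_setT.
rewrite {1}eA -(RintegralD measurableT ic i2).
apply: (le_Rintegral measurableT il is_) => x _.
by apply: le_trans (CP h x hd) _; rewrite -/p -/A; lra.
Qed.

(** At a local minimum the value at the point reflected through [mu] is at least
    the minimum, so the second difference bounds the increment itself. *)
Lemma frechet_quadratic_at_minimum (c : chart R n M) (mu : M) :
  atlas S c -> chart_dom c mu -> local_minimum (frechet g Q) mu ->
  exists C delta : R, [/\ 0 < delta, 0 <= C &
  forall y, `|y - chart_map c mu| <= delta ->
    `|frechet g Q (chart_inv c y) - frechet g Q mu| <= C * `|y - chart_map c mu| ^+ 2].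
Proof.
move=> ac dmu lmin; set x0 := chart_map c mu.
have ix0 : chart_img c x0 by exact: chart_mapP.
have [C [d1 [d10 C0 CP]]] := frechet_second_difference ac ix0.
have cinv := chart_inv_continuous ix0.
rewrite /prop_for /continuous_at /x0 chart_mapK // -/x0 in cinv.
have /nbhs_closedballP[d2 d2P] : \forall y \near x0, frechet g Q mu <= frechet g Q (chart_inv c y).
  exact: (cinv _ lmin).
have minP (y : 'rV[R]_n) : `|y - x0| <= d2%:num -> frechet g Q mu <= frechet g Q (chart_inv c y).
  by move=> yd; apply: d2P; rewrite closed_ballE // /closed_ball_ /= distrC.
exists C, (Num.min d1 d2%:num); split => //; first by rewrite lt_min d10 /=.
move=> y; rewrite le_min => /andP[y1 y2].
have yE : y = x0 + (y - x0) by rewrite addrC subrK.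
have := CP (y - x0) y1; rewrite -yE /x0 chart_mapK // -/x0.
have m1 := minP y y2.
have m2 : frechet g Q mu <= frechet g Q (chart_inv c (x0 - (y - x0))).
  by apply: minP; rewrite addrAC subrr add0r normrN.
rewrite ger0_norm ?subr_ge0 //; lra.
Qed.

(** No existence or uniqueness of geodesics is involved: any geodesic with initial
    velocity [t *: w] has constant speed proportional to [t], so that its value at
    time one is at distance of order [t]; and if there were none, [exp_map] would
    return the base point. *)
Lemma exp_map_close (c : chart R n M) (mu : M) (w : 'rV[R]_n) :
  atlas S c -> chart_dom c mu -> exists K tau : R, [/\ 0 < tau, 0 <= K &
  forall t, 0 < t -> t <= tau -> in_ball c (chart_map c mu) (K * t) (exp_map g mu (t *: w))].
Proof.
move=> ac dmu; set x0 := chart_map c mu.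
have ix0 : chart_img c x0 by exact: chart_mapP.
have [r [K G]] := near_good_ball g ac ix0.
have r0 := good_radius G; have K1 := good_const G.
pose v0 := Num.sqrt (inner g mu w w).
have v0_ge0 : 0 <= v0 by exact: sqrtr_ge0.
have D0 : 0 < 2 * K * (v0 + 1) by rewrite mulr_gt0 //; lra.
exists (K * v0), (r / (2 * K * (v0 + 1))); split.
- by rewrite divr_gt0.
- by rewrite mulr_ge0 //; lra.
move=> t t0 tle.
have Kvt : 0 <= K * v0 * t by rewrite !mulr_ge0 //; lra.
rewrite /exp_map; case: xgetP => [s _ [gs s0 vs]|_] /=; last first.
  by split => //; rewrite subrr normr0.
have sp0 : speed g s 0 = v0 * t.
  rewrite /speed vs s0 /inner bilinZl bilinZr mulrA -expr2 mulrC sqrtrM.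
    by rewrite sqrtr_sqr ger0_norm // ltW.
  by apply: bilin_gram_ge0; [exact: chart_at_atlas|apply: chart_mapP; exact: chart_at_dom].
pose ell (u : R) := (v0 * t) * u.
have Dell (u : R) : derivable ell u 1 /\ derive1 ell u = v0 * t.
  have did : derivable (id : R -> R) u 1 by exact: derivable_id.
  split; first exact: derivableM (derivable_cst _ _ _) did.
  by rewrite (derive1Ml (v0 * t) did) derive1_id mulr1.
have C := containment hausdorffM ac G (s := s) (ell := ell) (rho := v0 * t).
have e1 : ell 1 = v0 * t by rewrite /ell mulr1.
have := C _ _ _ _ 1; rewrite e1 mulrA; apply => //; last first.
- by rewrite ler01 lexx.
- rewrite /ell mulr0 => _; rewrite s0; split => //.
  by rewrite subrr normr0 mulr0.
- move=> u _; have [d ->] := Dell u; split => //.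
  by rewrite (geodesic_speed u gs) sp0.
- by move=> u _; exact: (geodesic_C1 u gs).
have : 2 * K * (v0 + 1) * t <= r by rewrite mulrC -ler_pdivlMr.
have : 0 < K * t by rewrite mulr_gt0 //; lra.
move: Kvt; lra.
Qed.

Lemma frechet_dirderiv (mu : M) (w : 'rV[R]_n) :
  local_minimum (frechet g Q) mu -> has_dirderiv g (frechet g Q) mu w 0.
Proof.
move=> lmin; pose c := chart_at S mu.
have ac : atlas S c by exact: chart_at_atlas.
have dmu : chart_dom c mu by exact: chart_at_dom.
have [C [delta [d0 C0 CP]]] := frechet_quadratic_at_minimum ac dmu lmin.
have [K [tau [tau0 K0 KP]]] := exp_map_close w ac dmu.
apply/cvgrPdist_le => e e0.
have D0 : 0 < C * K ^+ 2 + 1 by rewrite ltr_wpDl // mulr_ge0 // sqr_ge0.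
near=> t.
have t0 : 0 < t by near: t; exact: nbhs_right_gt.
have ttau : t <= tau by near: t; exact: nbhs_right_le.
have tdelta : t <= delta / (K + 1).
  by near: t; apply: nbhs_right_le; rewrite divr_gt0 // ltr_wpDl.
have te : t <= e / (C * K ^+ 2 + 1) by near: t; apply: nbhs_right_le; rewrite divr_gt0.
have [dq yq] := KP t t0 ttau.
set q := exp_map g mu (t *: w) in dq yq *.
have Kt : K * t <= delta.
  move: tdelta; rewrite ler_pdivlMr; [|lra]; lra.
have := CP (chart_map c q) (le_trans yq Kt); rewrite chart_mapK // => Fq.
rewrite sub0r normrN normrM normfV (gtr0_norm t0) ler_pdivrMr //.
apply: le_trans Fq _.
have le1 : C * `|chart_map c q - chart_map c mu| ^+ 2 <= C * (K * t) ^+ 2.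
  by rewrite ler_wpM2l // ler_pXn2r ?nnegrE ?mulr_ge0 // ltW.
apply: le_trans le1 _.
have -> : C * (K * t) ^+ 2 = (C * K ^+ 2) * t * t by ring.
rewrite ler_wpM2r ?(ltW t0) //.
move: te; rewrite ler_pdivlMr // => te.
by apply: le_trans te; rewrite mulrC ler_wpM2l ?(ltW t0) // lerDl.
Unshelve. all: by end_near. Qed.

End Frechet.

(** * The theorem *)

Theorem corollary4p2 (R : realType) (n : nat) (M : ptopologicalType)
    (S : smooth_structure R n M) (g : riemannian_metric S)
    (hausdorffM : hausdorff_space M)
    (second_countableM : @second_countable M)
    (connectedM : connected [set: M])
    (completeM : metrically_complete g)
    (dO : measure_display) (Omega : measurableType dO)
    (P : probability Omega R)
    (X : {RV P >-> g_sigma_algebraType (@open M)})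
    (finite_second_moment : exists q : M,
       (\int[distribution P X]_x ((dist g q x) ^+ 2)%:E < +oo)%E)
    (mu : M)
    (mu_min : local_minimum (frechet g (distribution P X)) mu) :
  differentiable_at S (frechet g (distribution P X)) mu /\
  forall w : 'rV[R]_n, has_dirderiv g (frechet g (distribution P X)) mu w 0.
Proof.
have conn := connected_joined g connectedM.
have [q0 moment] := finite_second_moment.
split=> [c ac dmu|w]; last exact: (frechet_dirderiv hausdorffM conn moment w mu_min).
have [C [delta [d0 C0 CP]]] :=
  frechet_quadratic_at_minimum hausdorffM conn moment ac dmu mu_min.
apply: (differentiable_of_quadratic d0 C0) => y yd /=.
by rewrite chart_mapK //; exact: CP.
Qed.
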